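(* Let $\mathsf{T}$ be a big tt-category equipped with the t-structure connectively generated by the tensor unit $\mathbf{1}$, and let $H^0$ be the induced zeroth cohomology functor. Then for all $X\in\mathsf{T}$ we have $$\mathrm{Hom}_{\mathsf{T}}(\mathbf{1},X)\cong\mathrm{Hom}_{\mathsf{T}}(\mathbf{1},H^0X),$$ and if $\mathsf{T}$ is affine we have an isomorphism of (untwisted) associated sheaves $$[\mathbf{1},X]^\#\cong[\mathbf{1},H^0X]^\#.$$ Thus, for $\mathsf{T}$ affine, the functor $H^0(-)$ can be chosen as an assignment $X\mapsto X^\heartsuit$ of a hearty replacement to every object $X$ of $\mathsf{T}$.
   Context: Big tt-category: a compactly generated triangulated category $\mathsf{T}$ with all set-indexed coproducts and suspension $\Sigma$, with a closed symmetric monoidal structure $(\otimes,\mathbf{1})$ such that $\otimes$ is exact and coproduct-preserving in each variable, $\Sigma$ is compatible with $\otimes$, and the full subcategory $\mathsf{T}^c$ of compact objects is a rigid tensor subcategory (in particular $\mathbf{1}\in\mathsf{T}^c$). $\mathrm{Spc}(\mathsf{T}^c)$ is the set of prime ideals of $\mathsf{T}^c$ (proper thick $\otimes$-ideals $\mathcal{P}$ such that $a\otimes b\in\mathcal{P}$ implies $a\in\mathcal{P}$ or $b\in\mathcal{P}$), with basis of open sets $U(a)=\{\mathcal{P}\mid a\in\mathcal{P}\}$, $a\in\mathsf{T}^c$; $\mathrm{supp}(a)=\{\mathcal{P}\mid a\notin\mathcal{P}\}$. For a quasi-compact open $U$ with closed complement $Z$, let $\mathsf{T}^c_Z=\{t\in\mathsf{T}^c\mid\mathrm{supp}(t)\subseteq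 Z\}$ and $\mathsf{T}(U)=\mathsf{T}/\mathrm{loc}(\mathsf{T}^c_Z)$ ($\mathrm{loc}$ = localising subcategory generated); $X_U$ is the image of $X$ in $\mathsf{T}(U)$. $\mathcal{O}_{\mathsf{T}}$ is the sheaf of rings associated to $U\mapsto\mathrm{End}_{\mathsf{T}(U)}(\mathbf{1}_U)$ ($U$ quasi-compact open), $\mathrm{Spec}(\mathsf{T})=(\mathrm{Spc}(\mathsf{T}^c),\mathcal{O}_{\mathsf{T}})$, and $[\mathbf{1},X]^\#$ is the $\mathcal{O}_{\mathsf{T}}$-module associated to $U\mapsto\mathrm{Hom}_{\mathsf{T}(U)}(\mathbf{1}_U,X_U)$. With $R_{\mathsf{T}}=\mathrm{End}_{\mathsf{T}}(\mathbf{1})$, Balmer's comparison map $\rho:\mathrm{Spec}(\mathsf{T})\to\mathrm{Spec}(R_{\mathsf{T}})$ is the map of locally ringed spaces $\rho(\mathcal{P})=\{f\in R_{\mathsf{T}}\mid\mathrm{cone}(f)\notin\mathcal{P}\}$, given on sections over $D(s)$ (with $\rho^{-1}(D(s))=U(\mathrm{cone}(s))$) by the isomorphism $R_{\mathsf{T}}[s^{-1}]\cong\mathrm{End}_{\mathsf{T}(U(\mathrm{cone}(s)))}(\mathbf{1})$ followed by sheafification. $\mathsf{T}$ is affine if $\rho$ is an isomorphism. ''$\mathbf{1}$ connectively generates a t-structure'': $\{\Sigma^i\mathbf{1}\}_{i\in\mathbb{Z}}$ is a generating set of $\mathsf{T}$ and $\mathrm{Hom}_{\mathsf{T}}(\mathbf{1},\Sigma^n\mathbf{1})=0$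 for all $n>0$; the t-structure is $\mathsf{T}^{\leq n}=\{X\mid\mathrm{Hom}_{\mathsf{T}}(\mathbf{1},\Sigma^iX)=0\ \forall i>n\}$, $\mathsf{T}^{\geq n}=\{X\mid\mathrm{Hom}_{\mathsf{T}}(\mathbf{1},\Sigma^iX)=0\ \forall i<n\}$. Its heart is $\mathsf{T}^\heartsuit=\mathsf{T}^{\leq0}\cap\mathsf{T}^{\geq0}$, and $H^n(X)=\tau^{\geq0}\tau^{\leq0}\Sigma^nX$ where $\tau^{\leq n},\tau^{\geq n}$ are the truncation functors. An object $X^\heartsuit\in\mathsf{T}^\heartsuit$ is a hearty replacement for $X$ if $[\mathbf{1},X]^\#\cong[\mathbf{1},X^\heartsuit]^\#$. *)

(* Defs.v *)
From HB Require Import structures.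
From mathcomp Require Import all_boot all_order all_algebra generic_quotient.
From mathcomp Require Import all_classical.
From mathcomp Require Import topology ring.

Set Implicit Arguments.
Unset Strict Implicit.
Unset Printing Implicit Defensive.

Import GRing.Theory.
Local Open Scope classical_set_scope.
Local Open Scope ring_scope.
Local Open Scope quotient_scope.

Reserved Notation "g \oc f" (at level 40, left associativity).

(* A universe for the index sets of coproducts.  It is a universe of its own
   because a category with coproducts indexed by its class of objects is a
   preorder: nothing below may force the objects to be [small]. *)
Definition small := Type.

Record addcat := AddCat {
  obj :> Type;
  hom : obj -> obj -> zmodType;
  idm : forall X, hom X X;
  comp : forall X Y Z, hom Y Z -> hom X Y -> hom X Z;
  comp1m : forall X Y (f : hom X Y), comp (idm Y) f = f;
  compm1 : forall X Y (f : hom X Y), comp f (idm X) = f;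
  compA : forall X Y Z W (h : hom Z W) (g : hom Y Z) (f : hom X Y),
    comp h (comp g f) = comp (comp h g) f;
  compDl : forall X Y Z (g g' : hom Y Z) (f : hom X Y),
    comp (g + g') f = comp g f + comp g' f;
  compDr : forall X Y Z (g : hom Y Z) (f f' : hom X Y),
    comp g (f + f') = comp g f + comp g f';
  zob : obj;
  idm_zob : idm zob = 0;
  dsum : obj -> obj -> obj;
  din1 : forall X Y, hom X (dsum X Y);
  din2 : forall X Y, hom Y (dsum X Y);
  dpr1 : forall X Y, hom (dsum X Y) X;
  dpr2 : forall X Y, hom (dsum X Y) Y;
  dpr1_in1 : forall X Y, comp (dpr1 X Y) (din1 X Y) = idm X;
  dpr2_in2 : forall X Y, comp (dpr2 X Y) (din2 X Y) = idm Y;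
  dpr1_in2 : forall X Y, comp (dpr1 X Y) (din2 X Y) = 0;
  dpr2_in1 : forall X Y, comp (dpr2 X Y) (din1 X Y) = 0;
  dsum_id : forall X Y,
    comp (din1 X Y) (dpr1 X Y) + comp (din2 X Y) (dpr2 X Y) = idm (dsum X Y)
}.

Notation "g \oc f" := (comp g f).

Section AddcatTheory.
Context {C : addcat}.
Implicit Types X Y Z : C.

Definition is_iso X Y (f : hom X Y) : Prop :=
  exists g : hom Y X, g \oc f = idm X /\ f \oc g = idm Y.

Definition isomorphic X Y : Prop := exists f : hom X Y, is_iso f.

Definition zero_object X : Prop := idm X = 0.

Lemma comp0m X Y Z (f : hom X Y) : (0 : hom Y Z) \oc f = 0.
Proof. by apply: (@addrI _ (0 \oc f)); rewrite -compDl !addr0. Qed.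

Lemma compm0 X Y Z (g : hom Y Z) : g \oc (0 : hom X Y) = 0.
Proof. by apply: (@addrI _ (g \oc 0)); rewrite -compDr !addr0. Qed.

Lemma compNm X Y Z (g : hom Y Z) (f : hom X Y) : (- g) \oc f = - (g \oc f).
Proof. by apply: (@addrI _ (g \oc f)); rewrite -compDl !subrr comp0m. Qed.

Lemma compmN X Y Z (g : hom Y Z) (f : hom X Y) : g \oc (- f) = - (g \oc f).
Proof. by apply: (@addrI _ (g \oc f)); rewrite -compDr !subrr compm0. Qed.

Lemma comp_suml (I : Type) (s : seq I) X Y Z (g : I -> hom Y Z) (f : hom X Y) :
  (\sum_(i <- s) g i) \oc f = \sum_(i <- s) (g i \oc f).
Proof.
elim: s => [|i s IH]; first by rewrite !big_nil comp0m.
by rewrite !big_cons compDl IH.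
Qed.

Lemma comp_sumr (I : Type) (s : seq I) X Y Z (g : hom Y Z) (f : I -> hom X Y) :
  g \oc (\sum_(i <- s) f i) = \sum_(i <- s) (g \oc f i).
Proof.
elim: s => [|i s IH]; first by rewrite !big_nil compm0.
by rewrite !big_cons compDr IH.
Qed.

Definition is_coproduct (I : small) (F : I -> C) (S : C)
    (inj : forall i, hom (F i) S) : Prop :=
  forall (Y : C) (g : forall i, hom (F i) Y),
    exists! h : hom S Y, forall i, h \oc inj i = g i.

End AddcatTheory.

Record functor (C D : addcat) := Functor {
  fobj :> C -> D;
  fmap : forall X Y, hom X Y -> hom (fobj X) (fobj Y);
  fmap1 : forall X, fmap (idm X) = idm (fobj X);
  fmapM : forall X Y Z (g : hom Y Z) (f : hom X Y),
    fmap (g \oc f) = fmap g \oc fmap f;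
  fmapD : forall X Y (f g : hom X Y), fmap (f + g) = fmap f + fmap g
}.
Arguments fmap {C D} _ {X Y} _.

Definition fun_id (C : addcat) : functor C C :=
  @Functor C C id (fun _ _ f => f) (fun=> erefl) (fun _ _ _ _ _ => erefl)
    (fun _ _ _ _ => erefl).

Section FunctorComposition.
Variables (C D E : addcat) (G : functor D E) (F : functor C D).

Let cmap X Y (f : hom X Y) := fmap G (fmap F f).

Let cmap1 X : cmap (idm X) = idm (G (F X)).
Proof. by rewrite /cmap !fmap1. Qed.

Let cmapM X Y Z (g : hom Y Z) (f : hom X Y) :
  cmap (g \oc f) = cmap g \oc cmap f.
Proof. by rewrite /cmap !fmapM. Qed.

Let cmapD X Y (f g : hom X Y) : cmap (f + g) = cmap f + cmap g.
Proof. by rewrite /cmap !fmapD. Qed.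

Definition fun_comp : functor C E := Functor cmap1 cmapM cmapD.

End FunctorComposition.

Record triangulated := Triangulated {
  tri_cat :> addcat;
  sus : functor tri_cat tri_cat;
  desus : functor tri_cat tri_cat;
  sus_unit : forall X, hom X (desus (sus X));
  sus_counit : forall X, hom (sus (desus X)) X;
  sus_unit_iso : forall X, is_iso (sus_unit X);
  sus_counit_iso : forall X, is_iso (sus_counit X);
  sus_unit_nat : forall X Y (f : hom X Y),
    sus_unit Y \oc f = fmap desus (fmap sus f) \oc sus_unit X;
  sus_counit_nat : forall X Y (f : hom X Y),
    f \oc sus_counit X = sus_counit Y \oc fmap sus (fmap desus f);
  distinguished : forall X Y Z, hom X Y -> hom Y Z -> hom Z (sus X) -> Prop;
  tri_iso : forall X Y Z (f : hom X Y) (g : hom Y Z) (h : hom Z (sus X))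
      X' Y' Z' (f' : hom X' Y') (g' : hom Y' Z') (h' : hom Z' (sus X'))
      (a : hom X X') (b : hom Y Y') (c : hom Z Z'),
    distinguished f g h -> is_iso a -> is_iso b -> is_iso c ->
    b \oc f = f' \oc a -> c \oc g = g' \oc b -> fmap sus a \oc h = h' \oc c ->
    distinguished f' g' h';
  tri_id : forall X,
    distinguished (idm X) (0 : hom X (zob tri_cat)) (0 : hom _ (sus X));
  cone : forall X Y, hom X Y -> tri_cat;
  cone_in : forall X Y (f : hom X Y), hom Y (cone f);
  cone_out : forall X Y (f : hom X Y), hom (cone f) (sus X);
  tri_cone : forall X Y (f : hom X Y),
    distinguished f (cone_in f) (cone_out f);
  tri_rot : forall X Y Z (f : hom X Y) (g : hom Y Z) (h : hom Z (sus X)),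
    distinguished f g h <-> distinguished g h (- fmap sus f);
  tri_map : forall X Y Z (f : hom X Y) (g : hom Y Z) (h : hom Z (sus X))
      X' Y' Z' (f' : hom X' Y') (g' : hom Y' Z') (h' : hom Z' (sus X'))
      (a : hom X X') (b : hom Y Y'),
    distinguished f g h -> distinguished f' g' h' -> b \oc f = f' \oc a ->
    exists c : hom Z Z', c \oc g = g' \oc b /\ fmap sus a \oc h = h' \oc c;
  tri_octahedron : forall X Y Z (f : hom X Y) (g : hom Y Z)
      A B C (f1 : hom Y A) (f2 : hom A (sus X))
      (g1 : hom Z B) (g2 : hom B (sus Y)) (k1 : hom Z C) (k2 : hom C (sus X)),
    distinguished f f1 f2 -> distinguished g g1 g2 ->
    distinguished (g \oc f) k1 k2 ->
    exists (u : hom A C) (v : hom C B),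
      [/\ distinguished u v (fmap sus f1 \oc g2),
          u \oc f1 = k1 \oc g, k2 \oc u = f2,
          v \oc k1 = g1 & g2 \oc v = fmap sus f \oc k2]
}.

Section TriangulatedTheory.
Variable T : triangulated.
Implicit Types X Y Z : T.

Definition sus_pow (i : int) : functor T T :=
  match i with
  | Posz n => iter n (fun_comp (sus T)) (fun_id T)
  | Negz n => iter n.+1 (fun_comp (desus T)) (fun_id T)
  end.

(* Closure under isomorphisms and the other forms of two out of three follow by
   rotation. *)
Definition triangulated_sub (L : set T) : Prop :=
  [/\ L (zob T),
      (forall X, L X -> L (sus T X)),
      (forall X, L X -> L (desus T X)) &
      (forall X Y Z (f : hom X Y) (g : hom Y Z) (h : hom Z (sus T X)),
        distinguished f g h -> L X -> L Y -> L Z)].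

Definition thick (L : set T) : Prop :=
  triangulated_sub L /\
  forall X Y (i : hom X Y) (r : hom Y X), r \oc i = idm X -> L Y -> L X.

End TriangulatedTheory.

Record bigtri := BigTri {
  bigtri_tri :> triangulated;
  hom_small : forall X Y : bigtri_tri,
    exists (S : small) (e : S -> hom X Y), bijective e;
  coprod : forall I : small, (I -> bigtri_tri) -> bigtri_tri;
  coin : forall (I : small) (F : I -> bigtri_tri) (i : I),
    hom (F i) (coprod F);
  coprodP : forall (I : small) (F : I -> bigtri_tri), is_coproduct (coin F)
}.

Section BigTriangulated.
Variable T : bigtri.
Implicit Types X Y Z c : T.

(* The canonical map from the direct sum of the [hom c (F i)] to
   [hom c (coprod F)] is always injective, so that its bijectivity means that
   every map to a coproduct factors through a finite subcoproduct. *)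
Definition compact_obj c : Prop :=
  forall (I : small) (F : I -> T) (f : hom c (coprod F)),
    exists s : seq {i : I & hom c (F i)},
      f = \sum_(p <- s) (coin F (projT1 p) \oc projT2 p).

Definition localising (L : set T) : Prop :=
  triangulated_sub L /\
  forall (I : small) (F : I -> T), (forall i, L (F i)) -> L (coprod F).

Definition loc (S : set T) : set T :=
  [set X | forall L, localising L -> S `<=` L -> L X].

Definition generating (I : Type) (G : I -> T) : Prop :=
  forall X, (forall i (f : hom (G i) X), f = 0) -> zero_object X.

Definition compactly_generated : Prop :=
  exists (I : small) (G : I -> T), (forall i, compact_obj (G i)) /\
    generating (fun p : I * int => sus_pow T p.2 (G p.1)).

End BigTriangulated.

Record monoidal (C : addcat) := Monoidal {
  unit : C;
  tens : C -> C -> C;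
  tmap : forall X X' Y Y', hom X X' -> hom Y Y' -> hom (tens X Y) (tens X' Y');
  tmap1 : forall X Y, tmap (idm X) (idm Y) = idm (tens X Y);
  tmapM : forall X X' X'' Y Y' Y'' (f' : hom X' X'') (f : hom X X')
      (g' : hom Y' Y'') (g : hom Y Y'),
    tmap (f' \oc f) (g' \oc g) = tmap f' g' \oc tmap f g;
  tmapDl : forall X X' Y Y' (f f' : hom X X') (g : hom Y Y'),
    tmap (f + f') g = tmap f g + tmap f' g;
  tmapDr : forall X X' Y Y' (f : hom X X') (g g' : hom Y Y'),
    tmap f (g + g') = tmap f g + tmap f g';
  tassoc : forall X Y Z, hom (tens (tens X Y) Z) (tens X (tens Y Z));
  tassoc_inv : forall X Y Z, hom (tens X (tens Y Z)) (tens (tens X Y) Z);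
  tlunit : forall X, hom (tens unit X) X;
  tlunit_inv : forall X, hom X (tens unit X);
  trunit : forall X, hom (tens X unit) X;
  trunit_inv : forall X, hom X (tens X unit);
  tswap : forall X Y, hom (tens X Y) (tens Y X);
  tassocK : forall X Y Z, tassoc_inv X Y Z \oc tassoc X Y Z = idm _;
  tassocVK : forall X Y Z, tassoc X Y Z \oc tassoc_inv X Y Z = idm _;
  tlunitK : forall X, tlunit_inv X \oc tlunit X = idm _;
  tlunitVK : forall X, tlunit X \oc tlunit_inv X = idm _;
  trunitK : forall X, trunit_inv X \oc trunit X = idm _;
  trunitVK : forall X, trunit X \oc trunit_inv X = idm _;
  tswapK : forall X Y, tswap Y X \oc tswap X Y = idm _;
  tassoc_nat : forall X X' Y Y' Z Z'
      (f : hom X X') (g : hom Y Y') (h : hom Z Z'),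
    tassoc X' Y' Z' \oc tmap (tmap f g) h
    = tmap f (tmap g h) \oc tassoc X Y Z;
  tlunit_nat : forall X X' (f : hom X X'),
    tlunit X' \oc tmap (idm unit) f = f \oc tlunit X;
  trunit_nat : forall X X' (f : hom X X'),
    trunit X' \oc tmap f (idm unit) = f \oc trunit X;
  tswap_nat : forall X X' Y Y' (f : hom X X') (g : hom Y Y'),
    tswap X' Y' \oc tmap f g = tmap g f \oc tswap X Y;
  tpentagon : forall X Y Z W,
    tassoc X Y (tens Z W) \oc tassoc (tens X Y) Z W
    = tmap (idm X) (tassoc Y Z W) \oc tassoc X (tens Y Z) W
        \oc tmap (tassoc X Y Z) (idm W);
  ttriangle : forall X Y,
    tmap (idm X) (tlunit Y) \oc tassoc X unit Y = tmap (trunit X) (idm Y);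
  (* Redundant, but part of Mac Lane's definition *)
  tlunit1 : tlunit unit = trunit unit;
  thexagon : forall X Y Z,
    tassoc Y Z X \oc tswap X (tens Y Z) \oc tassoc X Y Z
    = tmap (idm Y) (tswap X Z) \oc tassoc Y X Z \oc tmap (tswap X Y) (idm Z);
  tswap_unit : forall X, tlunit X \oc tswap X unit = trunit X
}.
Arguments unit {C} _.
Arguments tens {C} _ _ _.
Arguments tmap {C} _ {X X' Y Y'} _ _.

Section MonoidalTheory.
Variables (C : addcat) (M : monoidal C).

Definition is_dual (c d : C) (eta : hom (unit M) (tens M c d))
    (eps : hom (tens M d c) (unit M)) : Prop :=
  trunit M c \oc tmap M (idm c) eps \oc tassoc M c d c \oc tmap M eta (idm c)
    = tlunit M c /\
  tlunit M d \oc tmap M eps (idm d) \oc tassoc_inv M d c d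
    \oc tmap M (idm d) eta = trunit M d.

Definition closed_monoidal : Prop :=
  forall Y Z : C, exists (H : C) (ev : hom (tens M H Y) Z),
    forall (X : C) (f : hom (tens M X Y) Z),
      exists! g : hom X H, ev \oc tmap M g (idm Y) = f.

End MonoidalTheory.

(* By symmetry, exactness and preservation of coproducts in the first variable
   give the same in the second one. *)
Record bigtt := BigTT {
  tt_tri :> bigtri;
  tt_monoidal : monoidal tt_tri;
  tt_closed : closed_monoidal tt_monoidal;
  tt_coprod : forall (I : small) (F : I -> tt_tri) (Y : tt_tri),
    is_coproduct (fun i => tmap tt_monoidal (coin F i) (idm Y));
  tt_sus : forall X Y, hom (tens tt_monoidal (sus tt_tri X) Y)
                           (sus tt_tri (tens tt_monoidal X Y));
  tt_sus_iso : forall X Y, is_iso (tt_sus X Y);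
  tt_sus_nat : forall X X' Y Y' (f : hom X X') (g : hom Y Y'),
    tt_sus X' Y' \oc tmap tt_monoidal (fmap (sus tt_tri) f) g
    = fmap (sus tt_tri) (tmap tt_monoidal f g) \oc tt_sus X Y;
  tt_exact : forall X Y Z (f : hom X Y) (g : hom Y Z)
      (h : hom Z (sus tt_tri X)) W,
    distinguished f g h ->
    distinguished (tmap tt_monoidal f (idm W)) (tmap tt_monoidal g (idm W))
      (tt_sus X W \oc tmap tt_monoidal h (idm W));
  tt_sus_unit : forall X,
    fmap (sus tt_tri) (trunit tt_monoidal X) \oc tt_sus X (unit tt_monoidal)
    = trunit tt_monoidal (sus tt_tri X);
  tt_sus_assoc : forall X Y Z,
    tt_sus X (tens tt_monoidal Y Z)
      \oc tassoc tt_monoidal (sus tt_tri X) Y Z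
    = fmap (sus tt_tri) (tassoc tt_monoidal X Y Z)
      \oc tt_sus (tens tt_monoidal X Y) Z
      \oc tmap tt_monoidal (tt_sus X Y) (idm Z);
  tt_sus_sign : forall X Y,
    let sus_r X Y : hom (tens tt_monoidal X (sus tt_tri Y))
                        (sus tt_tri (tens tt_monoidal X Y)) :=
      fmap (sus tt_tri) (tswap tt_monoidal Y X) \oc tt_sus Y X
        \oc tswap tt_monoidal X (sus tt_tri Y) in
    fmap (sus tt_tri) (sus_r X Y) \oc tt_sus X (sus tt_tri Y)
    = - (fmap (sus tt_tri) (tt_sus X Y) \oc sus_r (sus tt_tri X) Y);
  tt_compactly_generated : compactly_generated tt_tri;
  tt_unit_compact : compact_obj (unit tt_monoidal);
  tt_tens_compact : forall c d : tt_tri, compact_obj c -> compact_obj d ->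
    compact_obj (tens tt_monoidal c d);
  tt_rigid : forall c : tt_tri, compact_obj c ->
    exists (d : tt_tri) eta eps,
      compact_obj d /\ is_dual (M := tt_monoidal) (c := c) (d := d) eta eps
}.

Notation "''1_' T" := (unit (tt_monoidal T)) (at level 8, T at level 2).
Notation "X \ot Y" := (tens (tt_monoidal _) X Y)
  (at level 40, left associativity).

Section UnitEndomorphisms.
Variable T : bigtt.

Definition unit_end : Type := hom '1_T '1_T.
HB.instance Definition _ := GRing.Zmodule.on unit_end.

Let umul (f g : unit_end) : unit_end := comp f g.

Let umulA : associative umul.
Proof. by move=> f g h; rewrite /umul compA. Qed.

Let umulC : commutative umul.
Proof.
pose M := tt_monoidal T; pose l := tlunit M '1_T; pose l' := tlunit_inv M '1_T.
have ll' : l \oc l' = idm _ by rewrite /l /l' tlunitVK.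
have l'l : l' \oc l = idm _ by rewrite /l /l' tlunitK.
have fl (f : hom '1_T '1_T) : f = l \oc tmap M (idm _) f \oc l'.
  by rewrite /l tlunit_nat -/l -compA ll' compm1.
have fr (f : hom '1_T '1_T) : f = l \oc tmap M f (idm _) \oc l'.
  by rewrite /l tlunit1 trunit_nat -tlunit1 -/l -compA ll' compm1.
have cj (a b : hom (tens M '1_T '1_T) (tens M '1_T '1_T)) :
  (l \oc a \oc l') \oc (l \oc b \oc l') = l \oc (a \oc b) \oc l'.
  by rewrite !compA -(compA _ l') l'l compm1.
move=> f g; rewrite /umul [in LHS](fl f) [in LHS](fr g) cj.
rewrite [in RHS](fr g) [in RHS](fl f) cj -!tmapM !comp1m !compm1.
by [].
Qed.

Let umul1 : left_id (idm '1_T : unit_end) umul.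
Proof. by move=> f; rewrite /umul comp1m. Qed.

Let umulDl : left_distributive umul +%R.
Proof. by move=> f g h; rewrite /umul compDl. Qed.

HB.instance Definition _ :=
  GRing.Zmodule_isComPzRing.Build unit_end umulA umulC umul1 umulDl.

End UnitEndomorphisms.

Section CompactCones.
Variable T : bigtri.
Implicit Types X Y Z c : T.

Let fmap0 (C D : addcat) (F : functor C D) (X Y : C) : fmap F (0 : hom X Y) = 0.
Proof. by apply: (@addrI _ (fmap F 0)); rewrite -fmapD !addr0. Qed.

Let fmap_sum (C D : addcat) (F : functor C D) (X Y : C) (J : Type) (s : seq J)
    (g : J -> hom X Y) :
  fmap F (\sum_(i <- s) g i) = \sum_(i <- s) fmap F (g i).
Proof.
elim: s => [|i r IH]; last by rewrite !big_cons fmapD IH.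
by rewrite !big_nil fmap0.
Qed.

Let is_coproduct_hom_eq (C : addcat) (I : small) (F : I -> C) (S : C)
    (inj : forall i, hom (F i) S) (Y : C) (u v : hom S Y) :
  is_coproduct inj -> (forall i, u \oc inj i = v \oc inj i) -> u = v.
Proof.
move=> /(_ Y (fun i => v \oc inj i)) [w [_ uniqw]] uv.
by rewrite -(uniqw u) // -(uniqw v).
Qed.

Let desus_inj X Y (f g : hom X Y) :
  fmap (desus T) f = fmap (desus T) g -> f = g.
Proof.
move=> e; have [k [_ kK]] := sus_counit_iso X.
by rewrite -[f]compm1 -[g]compm1 -kK !compA !sus_counit_nat e.
Qed.

Let sus_full X Y (f : hom (sus T X) (sus T Y)) :
  exists g : hom X Y, f = fmap (sus T) g.
Proof.
have [k [kl kr]] := sus_unit_iso Y; have [m [ml mr]] := sus_unit_iso X.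
exists (k \oc fmap (desus T) f \oc sus_unit X); apply: desus_inj.
set g := k \oc _ \oc _.
have : fmap (desus T) (fmap (sus T) g) \oc sus_unit X
       = fmap (desus T) f \oc sus_unit X.
  by rewrite -sus_unit_nat /g !compA kr comp1m.
by move=> /(congr1 (fun h => h \oc m)); rewrite -!compA mr !compm1.
Qed.

Lemma compact_sus c : compact_obj c -> compact_obj (sus T c).
Proof.
move=> cc I F f; pose G i := desus T (F i).
have counitV i : exists e : hom (F i) (sus T (G i)),
    sus_counit (F i) \oc e = idm _.
  by have [e [_ eK]] := sus_counit_iso (F i); exists e.
pose e i := projT1 (cid (counitV i)).
have eK i : sus_counit (F i) \oc e i = idm _ := projT2 (cid (counitV i)).
have [w [wP _]] := coprodP (fun i => fmap (sus T) (coin G i) \oc e i).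
have [v [vP _]] := coprodP (fun i => fmap (desus T) (coin F i)).
pose v' := sus_counit (coprod F) \oc fmap (sus T) v.
have v'P i : v' \oc fmap (sus T) (coin G i) = coin F i \oc sus_counit (F i).
  by rewrite -compA -fmapM vP sus_counit_nat.
have wK : v' \oc w = idm _.
  apply: (is_coproduct_hom_eq (@coprodP _ _ F)) => i.
  by rewrite -compA wP comp1m compA v'P -compA eK compm1.
have [t tE] := sus_full (w \oc f).
have [s tsum] := cc I G t.
exists [seq existT _ (projT1 p) (sus_counit (F (projT1 p))
                                  \oc fmap (sus T) (projT2 p)) | p <- s].
rewrite -[LHS]comp1m -wK -compA tE tsum fmap_sum comp_sumr big_map.
by apply: eq_bigr => p _; rewrite fmapM compA v'P -compA.
Qed.

Let tri_factor X Y Z (f : hom X Y) (g : hom Y Z) (h : hom Z (sus T X)) W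
    (u : hom Z W) :
  distinguished f g h -> u \oc g = 0 -> exists v, u = v \oc h.
Proof.
move=> /tri_rot d ug0.
have id0 : fmap (sus T) (idm (zob T)) = 0 by rewrite idm_zob fmap0.
have dW : distinguished (0 : hom (zob T) W) (idm W) 0.
  apply/tri_rot; rewrite fmap0 oppr0.
  have isoid : is_iso (idm W) by exists (idm W); rewrite comp1m.
  have iso0 : is_iso (0 : hom (zob T) (sus T (zob T))).
    by exists 0; rewrite !comp0m idm_zob -fmap1 id0.
  by apply: (tri_iso (tri_id W) isoid isoid iso0);
    rewrite ?compm0 ?comp0m ?comp1m.
have [|v [vh _]] := tri_map (a := 0) (b := u) d dW; first by rewrite ug0 comp0m.
by exists v; rewrite vh comp1m.
Qed.

Section FiniteMaps.
Variables (I : small) (F : I -> T).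

Let fin X (f : hom X (coprod F)) :=
  exists s : seq {i : I & hom X (F i)},
    f = \sum_(p <- s) (coin F (projT1 p) \oc projT2 p).

Let finD X (f g : hom X (coprod F)) : fin f -> fin g -> fin (f + g).
Proof. by move=> [s ->] [t ->]; exists (s ++ t); rewrite big_cat. Qed.

Let fin_comp X Y (f : hom Y (coprod F)) (g : hom X Y) : fin f -> fin (f \oc g).
Proof.
move=> [s ->]; exists [seq existT _ (projT1 p) (projT2 p \oc g) | p <- s].
by rewrite comp_suml big_map; apply: eq_bigr => p _; rewrite compA.
Qed.

Let fin1 i X (f : hom X (F i)) : fin (coin F i \oc f).
Proof. by exists [:: existT _ i f]; rewrite big_seq1. Qed.

Let coproj i : exists r : hom (coprod F) (F i),
  r \oc coin F i = idm _ /\ forall j, j <> i -> r \oc coin F j = 0.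
Proof.
pose g j : hom (F j) (F i) :=
  if pselect (j = i) is left e then ecast k (hom (F j) (F k)) e (idm (F j))
  else 0.
have [r [rP _]] := coprodP g.
exists r; split=> [|j ji]; rewrite rP /g; case: pselect => // e.
by rewrite (Prop_irrelevance e erefl).
Qed.

Let finite_projector (s : seq {classic I}) : exists p : hom (coprod F) (coprod F),
  fin p /\ forall j : {classic I}, j \in s -> p \oc coin F j = coin F j.
Proof.
elim: s => [|i s [p [finp pP]]]; first by exists 0; split=> //; exists [::];
  rewrite big_nil.
have [r [r1 r0]] := coproj i.
exists (p + (coin F i \oc r - p \oc coin F i \oc r)); split=> [|j].
  apply: finD => //; apply: finD => //.
  by rewrite -compA -compmN; apply: fin_comp.
rewrite !compDl compNm -!compA.
rewrite inE; have [-> _|ji /= /pP pj] := eqVneq j i.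
  by rewrite r1 !compm1 addrC subrK.
by rewrite (r0 j (elimN eqP ji)) pj !compm0 subrr addr0.
Qed.

Lemma compact_cone_fin X Y (f : hom X Y) (u : hom (cone f) (coprod F)) :
  compact_obj X -> compact_obj Y -> fin u.
Proof.
move=> cX cY; have [s us] := cY I F (u \oc cone_in f).
have [p [finp pP]] := finite_projector [seq projT1 q | q <- s].
have pu : p \oc (u \oc cone_in f) = u \oc cone_in f.
  rewrite us comp_sumr; elim: s pP {us} => [|q s IH] pP; first by rewrite !big_nil.
  rewrite !big_cons IH => [|j js]; last by apply: pP; rewrite inE js orbT.
  by rewrite compA pP // inE eqxx.
have [|v uv] := tri_factor (u := u - p \oc u) (tri_cone f).
  by rewrite compDl compNm -compA pu subrr.
rewrite -[u](subrK (p \oc u)) uv; apply: finD; apply: fin_comp => //.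
exact: compact_sus.
Qed.

End FiniteMaps.

Lemma compact_cone X Y (f : hom X Y) :
  compact_obj X -> compact_obj Y -> compact_obj (cone f).
Proof. by move=> cX cY I F u; apply: compact_cone_fin. Qed.

End CompactCones.

(* Words in the maps of [C] and formal inverses of the maps of [W]; modulo
   [lrel] they are the maps of the localisation [C[W^-1]], the preadditive
   category universal among those with an additive functor from [C] inverting
   [W].  When [W] is the class of maps with cone in a localising subcategory
   [L], this is the Verdier quotient of [C] by [L]: its usual construction by
   fractions is additive, and has the universal property of [C[W^-1]] with
   respect to all functors, hence to additive ones. *)
Section Localisation.
Variables (C : addcat) (W : forall X Y : C, hom X Y -> Prop).

Inductive lterm : C -> C -> Type :=
| LGen X Y : hom X Y -> lterm X Y
| LInv X Y (f : hom X Y) : W f -> lterm Y X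
| LComp X Y Z : lterm Y Z -> lterm X Y -> lterm X Z
| LAdd X Y : lterm X Y -> lterm X Y -> lterm X Y.

Inductive lrel : forall X Y, lterm X Y -> lterm X Y -> Prop :=
| lrel_refl X Y (t : lterm X Y) : lrel t t
| lrel_sym X Y (t u : lterm X Y) : lrel t u -> lrel u t
| lrel_trans X Y (t u v : lterm X Y) : lrel t u -> lrel u v -> lrel t v
| lrel_comp X Y Z (t t' : lterm Y Z) (u u' : lterm X Y) :
    lrel t t' -> lrel u u' -> lrel (LComp t u) (LComp t' u')
| lrel_add X Y (t t' u u' : lterm X Y) :
    lrel t t' -> lrel u u' -> lrel (LAdd t u) (LAdd t' u')
| lrel_compA X Y Z V (t : lterm Z V) (u : lterm Y Z) (v : lterm X Y) :
    lrel (LComp t (LComp u v)) (LComp (LComp t u) v)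
| lrel_comp1m X Y (t : lterm X Y) : lrel (LComp (LGen (idm Y)) t) t
| lrel_compm1 X Y (t : lterm X Y) : lrel (LComp t (LGen (idm X))) t
| lrel_compDl X Y Z (t u : lterm Y Z) (v : lterm X Y) :
    lrel (LComp (LAdd t u) v) (LAdd (LComp t v) (LComp u v))
| lrel_compDr X Y Z (t : lterm Y Z) (u v : lterm X Y) :
    lrel (LComp t (LAdd u v)) (LAdd (LComp t u) (LComp t v))
| lrel_addA X Y (t u v : lterm X Y) :
    lrel (LAdd t (LAdd u v)) (LAdd (LAdd t u) v)
| lrel_addC X Y (t u : lterm X Y) : lrel (LAdd t u) (LAdd u t)
| lrel_add0 X Y (t : lterm X Y) : lrel (LAdd (LGen 0) t) t
| lrel_addN X Y (t : lterm X Y) :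
    lrel (LAdd (LComp (LGen (- idm Y)) t) t) (LGen 0)
| lrel_genM X Y Z (g : hom Y Z) (f : hom X Y) :
    lrel (LGen (g \oc f)) (LComp (LGen g) (LGen f))
| lrel_genD X Y (f g : hom X Y) : lrel (LGen (f + g)) (LAdd (LGen f) (LGen g))
| lrel_invl X Y (f : hom X Y) (wf : W f) :
    lrel (LComp (LInv wf) (LGen f)) (LGen (idm X))
| lrel_invr X Y (f : hom X Y) (wf : W f) :
    lrel (LComp (LGen f) (LInv wf)) (LGen (idm Y)).

Section Hom.
Variables X Y : C.

HB.instance Definition _ := gen_eqMixin (lterm X Y).
HB.instance Definition _ := gen_choiceMixin (lterm X Y).

Definition lequiv (t u : lterm X Y) : bool := `[< lrel t u >].

Lemma lequiv_refl : reflexive lequiv.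
Proof. by move=> t; apply/asboolP; apply: lrel_refl. Qed.

Lemma lequiv_sym : symmetric lequiv.
Proof. by move=> t u; apply/asboolP/asboolP; apply: lrel_sym. Qed.

Lemma lequiv_trans : transitive lequiv.
Proof.
by move=> u t v /asboolP tu /asboolP uv; apply/asboolP; apply: lrel_trans uv.
Qed.

Canonical lequiv_equiv := EquivRel lequiv lequiv_refl lequiv_sym lequiv_trans.

Definition lhom := {eq_quot lequiv}.
HB.instance Definition _ : EqQuotient _ lequiv lhom := EqQuotient.on lhom.
HB.instance Definition _ := Choice.on lhom.

End Hom.

Definition lpi X Y (t : lterm X Y) : lhom X Y := \pi t.

Lemma lpiP X Y (t u : lterm X Y) : lpi t = lpi u <-> lrel t u.
Proof.
split=> [/eqmodP/asboolP//|tu].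
by apply/eqmodP/asboolP.
Qed.

Lemma lpi_repr X Y (t : lhom X Y) : lpi (repr t) = t.
Proof. exact: reprK. Qed.

Lemma lrel_repr X Y (t : lterm X Y) : lrel (repr (lpi t)) t.
Proof. by apply/lpiP; rewrite lpi_repr. Qed.

Definition lgen X Y (f : hom X Y) : lhom X Y := lpi (LGen f).

Definition linv X Y (f : hom X Y) (wf : W f) : lhom Y X := lpi (LInv wf).

Definition lcomp X Y Z (g : lhom Y Z) (f : lhom X Y) : lhom X Z :=
  lpi (LComp (repr g) (repr f)).

Definition ladd X Y (f g : lhom X Y) : lhom X Y := lpi (LAdd (repr f) (repr g)).

Definition lopp X Y (f : lhom X Y) : lhom X Y := lcomp (lgen (- idm Y)) f.

Lemma lpi_comp X Y Z (t : lterm Y Z) (u : lterm X Y) :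
  lcomp (lpi t) (lpi u) = lpi (LComp t u).
Proof. by apply/lpiP; apply: lrel_comp; apply: lrel_repr. Qed.

Lemma lpi_add X Y (t u : lterm X Y) : ladd (lpi t) (lpi u) = lpi (LAdd t u).
Proof. by apply/lpiP; apply: lrel_add; apply: lrel_repr. Qed.

Section HomZmodule.
Variables X Y : C.

Let laddA : associative (@ladd X Y).
Proof.
move=> f g h; rewrite -[f]lpi_repr -[g]lpi_repr -[h]lpi_repr !lpi_add.
by apply/lpiP; apply: lrel_addA.
Qed.

Let laddC : commutative (@ladd X Y).
Proof.
move=> f g; rewrite -[f]lpi_repr -[g]lpi_repr !lpi_add.
by apply/lpiP; apply: lrel_addC.
Qed.

Let ladd0 : left_id (lgen (0 : hom X Y)) (@ladd X Y).
Proof.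
by move=> f; rewrite -[f]lpi_repr lpi_add; apply/lpiP; apply: lrel_add0.
Qed.

Let laddN : left_inverse (lgen (0 : hom X Y)) (@lopp X Y) (@ladd X Y).
Proof.
move=> f; rewrite -[f]lpi_repr /lopp lpi_comp lpi_add.
by apply/lpiP; apply: lrel_addN.
Qed.

HB.instance Definition _ :=
  GRing.isZmodule.Build (lhom X Y) laddA laddC ladd0 laddN.

End HomZmodule.
End Localisation.

Arguments lgen {C W X Y} f.
Arguments linv {C W X Y f} wf.
Arguments lcomp {C W X Y Z} g f.

Section LocalisationMap.
Variables (C : addcat) (W W' : forall X Y : C, hom X Y -> Prop).
Hypothesis sWW' : forall X Y (f : hom X Y), W f -> W' f.

Fixpoint lterm_map X Y (t : lterm W X Y) : lterm W' X Y :=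
  match t with
  | LGen _ _ f => LGen W' f
  | LInv _ _ _ wf => LInv (sWW' wf)
  | LComp _ _ _ t u => LComp (lterm_map t) (lterm_map u)
  | LAdd _ _ t u => LAdd (lterm_map t) (lterm_map u)
  end.

Definition lmap X Y (f : lhom W X Y) : lhom W' X Y := lpi (lterm_map (repr f)).

Lemma lrel_map X Y (t u : lterm W X Y) :
  lrel t u -> lrel (lterm_map t) (lterm_map u).
Proof. by elim=> /= *; eauto using lrel. Qed.

Lemma lpi_map X Y (t : lterm W X Y) : lmap (lpi t) = lpi (lterm_map t).
Proof. by apply/lpiP; apply: lrel_map; apply: lrel_repr. Qed.

End LocalisationMap.

Section LocalisationMapTheory.
Variable C : addcat.
Variables W W' W'' : forall X Y : C, hom X Y -> Prop.
Variables (X Y : C) (f : lhom W X Y).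

Lemma lmap_id (s : forall X Y (f : hom X Y), W f -> W f) : lmap s f = f.
Proof.
rewrite -[f]lpi_repr lpi_map; congr lpi.
elim: (repr f) => //= X' Y'.
- by move=> g w; rewrite (Prop_irrelevance (s _ _ _ w) w).
- by move=> Z t -> u ->.
- by move=> t -> u ->.
Qed.

Lemma lmap_comp (s : forall X Y (f : hom X Y), W f -> W' f)
    (s' : forall X Y (f : hom X Y), W' f -> W'' f)
    (s'' : forall X Y (f : hom X Y), W f -> W'' f) :
  lmap s' (lmap s f) = lmap s'' f.
Proof.
rewrite -[f]lpi_repr !lpi_map; congr lpi.
elim: (repr f) => //= X' Y'.
- by move=> g w; rewrite (Prop_irrelevance (s' _ _ _ _) (s'' _ _ _ w)).
- by move=> Z t -> u ->.
- by move=> t -> u ->.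
Qed.

End LocalisationMapTheory.

Record presheaf (X : Type) := Presheaf {
  psec :> set X -> Type;
  pres : forall U V, V `<=` U -> psec U -> psec V;
  pres_id : forall U (h : U `<=` U) (a : psec U), pres h a = a;
  pres_comp : forall U V W (hV : V `<=` U) (hW : W `<=` V) (hU : W `<=` U)
    (a : psec U), pres hW (pres hV a) = pres hU a
}.

(* Only the sections of [F] over the members of the basis [B] of the topology
   matter below.  The germ at [x] of a section [a] over a neighbourhood [U] of
   [x] is the class of the pairs [(V, b)] with [a] and [b] equal on a
   neighbourhood of [x]; a section over [V] of the associated sheaf is a
   function to germs, locally given by sections of [F], extended by the junk
   value [set0] outside of [V]. *)
Section AssociatedSheaf.
Variables (X : Type) (B : set (set X)).

Definition germ_fun (F : presheaf X) := X -> set {U : set X & F U}.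

Definition germ (F : presheaf X) (U : set X) (a : F U) : germ_fun F :=
  fun x => [set q | [/\ B (projT1 q), projT1 q x &
    exists (V : set X) (hU : V `<=` U) (hq : V `<=` projT1 q),
      [/\ B V, V x & pres hU a = pres hq (projT2 q)]]].

Definition sheafify (F : presheaf X) (V : set X) : set (germ_fun F) :=
  [set s | (forall x, ~ V x -> s x = set0) /\
    forall x, V x -> exists (U : set X) (a : F U),
      [/\ B U, U x, U `<=` V & forall y, U y -> s y = germ a y]].

Definition sec_res (F : presheaf X) (V : set X) (s : germ_fun F) : germ_fun F :=
  fun x => [set q | V x /\ s x q].

(* The operation on sections of the associated sheaves induced by an operation
   [op] on sections of the presheaves *)
Definition sec_op (F G H : presheaf X) (op : forall U, F U -> G U -> H U)
    (s : germ_fun F) (t : germ_fun G) : germ_fun H :=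
  fun x => [set q | exists (U : set X) (a : F U) (b : G U),
    [/\ B U, U x, s x = germ a x, t x = germ b x & germ (op U a b) x q]].

End AssociatedSheaf.

Section RingSpectrum.
Variable R : comPzRingType.

Record Spec := MkSpec {
  prime_set :> set R;
  prime_set0 : prime_set 0;
  prime_setD : forall x y, prime_set x -> prime_set y -> prime_set (x + y);
  prime_setM : forall x y, prime_set y -> prime_set (x * y);
  prime_set1 : ~ prime_set 1;
  prime_set_prime : forall x y,
    prime_set (x * y) -> prime_set x \/ prime_set y
}.

HB.instance Definition _ := gen_eqMixin Spec.
HB.instance Definition _ := gen_choiceMixin Spec.

(* These too form a basis, as [Dopen s `&` Dopen t] is [Dopen (s * t)]. *)
Definition Dopen (s : R) : set Spec := [set p : Spec | ~ prime_set p s].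

HB.instance Definition _ :=
  @isSubBaseTopological.Build Spec (set Spec) (range Dopen) id.

(* As in EGA, the ring of fractions [R[s^-1]] is taken with denominators all
   the elements that are invertible on [D(s)], so that the restrictions are the
   evident maps. *)
Definition denom (U : set Spec) : set R := [set f | U `<=` Dopen f].

Section Fractions.
Variable U : set Spec.

Definition prefrac := {x : R * R | `[< denom U x.2 >]}.
HB.instance Definition _ := Choice.on prefrac.

Definition frac_eq (x y : prefrac) : bool :=
  `[< exists2 u, denom U u &
      u * ((val x).1 * (val y).2) = u * ((val y).1 * (val x).2) >].

Let denom1 : denom U 1.
Proof. by move=> p _ /prime_set1. Qed.

Let denomM x y : denom U x -> denom U y -> denom U (x * y).
Proof.
by move=> ux uy p Up /prime_set_prime[]; [apply: ux Up|apply: uy Up].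
Qed.

Lemma frac_eq_refl : reflexive frac_eq.
Proof. by move=> x; apply/asboolP; exists 1. Qed.

Lemma frac_eq_sym : symmetric frac_eq.
Proof. by move=> x y; apply/asboolP/asboolP => -[u Uu e]; exists u. Qed.

Lemma frac_eq_trans : transitive frac_eq.
Proof.
move=> [[b t] dt] [[a s] ds] [[c w] dw]; have Ut : denom U t := asboolW dt.
move=> /asboolP[u Uu /= e] /asboolP[v Uv /= e']; apply/asboolP.
exists (u * v * t); first by apply: denomM => //; apply: denomM.
rewrite /=.
have -> : u * v * t * (a * w) = v * w * (u * (a * t)) by ring.
have -> : u * v * t * (c * s) = u * s * (v * (c * t)) by ring.
by rewrite e -e'; ring.
Qed.

Canonical frac_equiv := EquivRel frac_eq frac_eq_refl frac_eq_sym frac_eq_trans.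

Definition fracs := {eq_quot frac_eq}.
HB.instance Definition _ : EqQuotient _ frac_eq fracs := EqQuotient.on fracs.
HB.instance Definition _ := Choice.on fracs.

Definition fpi (x : prefrac) : fracs := \pi x.

Lemma fpiP (x y : prefrac) : fpi x = fpi y <-> frac_eq x y.
Proof. by split=> [/eqmodP|?]; last exact/eqmodP. Qed.

Lemma fpi_repr (x : fracs) : fpi (repr x) = x.
Proof. exact: reprK. Qed.

End Fractions.

Lemma denom_sub (U V : set Spec) : V `<=` U -> denom U `<=` denom V.
Proof. by move=> VU f Uf p /VU/Uf. Qed.

Lemma prefrac_sub (U V : set Spec) (VU : V `<=` U) (x : prefrac U) :
  `[< denom V (val x).2 >].
Proof. by apply/asboolT/(denom_sub VU); apply: asboolW (valP x). Qed.

Definition prefrac_res (U V : set Spec) (VU : V `<=` U) (x : prefrac U) :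
    prefrac V :=
  exist _ (val x) (prefrac_sub VU x).

Definition frac_res (U V : set Spec) (VU : V `<=` U) (x : fracs U) : fracs V :=
  fpi (prefrac_res VU (repr x)).

Lemma frac_res_fpi (U V : set Spec) (VU : V `<=` U) (x : prefrac U) :
  frac_res VU (fpi x) = fpi (prefrac_res VU x).
Proof.
have /fpiP/asboolP[u Uu e] := fpi_repr (fpi x).
by apply/fpiP/asboolP; exists u => //; apply: (denom_sub VU).
Qed.

Lemma frac_res_id (U : set Spec) (h : U `<=` U) (x : fracs U) :
  frac_res h x = x.
Proof. by rewrite -[x]fpi_repr frac_res_fpi; congr fpi; apply: val_inj. Qed.

Lemma frac_res_comp (U V W : set Spec) (hV : V `<=` U) (hW : W `<=` V)
    (hU : W `<=` U) (x : fracs U) :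
  frac_res hW (frac_res hV x) = frac_res hU x.
Proof. by rewrite -[x]fpi_repr !frac_res_fpi; congr fpi; apply: val_inj. Qed.

(* The structure sheaf of [Spec R] is the sheaf associated to this presheaf,
   with respect to the basis [Dbasis]. *)
Definition frac_presheaf : presheaf Spec := Presheaf frac_res_id frac_res_comp.

Definition Dbasis : set (set Spec) := range Dopen.

End RingSpectrum.

Section TTSpectrum.
Variable T : bigtt.
Implicit Types X Y c : T.

Definition prime_ideal (P : set T) : Prop :=
  [/\ P `<=` @compact_obj T, thick P,
      (forall a c, P a -> compact_obj c -> P (a \ot c)),
      (exists2 c, compact_obj c & ~ P c) &
      (forall a b, compact_obj a -> compact_obj b ->
        P (a \ot b) -> P a \/ P b)].

Record Spc := MkSpc {
  tt_prime :> set T;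
  tt_prime_ideal : prime_ideal tt_prime
}.

HB.instance Definition _ := gen_eqMixin Spc.
HB.instance Definition _ := gen_choiceMixin Spc.

(* The [Uopen a] form a basis, and not only a subbasis, of the topology below,
   since [Uopen a `&` Uopen b] is [Uopen (dsum a b)]. *)
Definition Uopen a : set Spc := [set P : Spc | tt_prime P a].

HB.instance Definition _ :=
  @isSubBaseTopological.Build Spc (set Spc) (Uopen @` @compact_obj T) id.

Definition supp a : set Spc := [set P : Spc | ~ tt_prime P a].

Definition supported (Z : set Spc) : set T :=
  [set t | compact_obj t /\ supp t `<=` Z].

Definition qc_open : set (set Spc) := [set U | open U /\ compact U].

(* [hom_over U X Y] is the group of maps from [X_U] to [Y_U] in the quotient
   [T(U)] of [T] by [loc (supported (~` U))]. *)
Definition inverted (U : set Spc) X Y (f : hom X Y) : Prop :=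
  loc (supported (~` U)) (cone f).

Definition hom_over (U : set Spc) X Y := lhom (inverted U) X Y.

Lemma inverted_sub (U V : set Spc) : V `<=` U ->
  forall X Y (f : hom X Y), inverted U f -> inverted V f.
Proof.
move=> VU X Y f Uf L locL sL; apply: Uf => // t [ct st]; apply: sL.
by split=> // P /st nUP /VU.
Qed.

Definition unit_hom_presheaf X : presheaf Spc :=
  @Presheaf Spc (fun U => hom_over U '1_T X)
    (fun U V VU => @lmap _ _ _ (inverted_sub VU) _ _)
    (fun U h a => lmap_id a _)
    (fun U V W hV hW hU a => lmap_comp a _ _ _).

(* [[1, X]^#]; in particular [unit_hom_sheaf '1_T] is the structure sheaf. *)
Definition unit_hom_sheaf X (V : set Spc) : set (germ_fun (unit_hom_presheaf X)) :=
  sheafify qc_open V.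
Arguments unit_hom_sheaf : clear implicits.

Definition over_add X (U : set Spc) (f g : unit_hom_presheaf X U) :
    unit_hom_presheaf X U :=
  (f : hom_over U '1_T X) + g.

Definition over_scale X (U : set Spc) (f : unit_hom_presheaf X U)
    (r : unit_hom_presheaf '1_T U) : unit_hom_presheaf X U :=
  lcomp f r.

Definition sec_add X : germ_fun (unit_hom_presheaf X) ->
    germ_fun (unit_hom_presheaf X) -> germ_fun (unit_hom_presheaf X) :=
  sec_op qc_open (@over_add X).

Definition sec_scale X : germ_fun (unit_hom_presheaf X) ->
    germ_fun (unit_hom_presheaf '1_T) -> germ_fun (unit_hom_presheaf X) :=
  sec_op qc_open (@over_scale X).

(* Isomorphism of modules over the structure sheaf; the values of [phi V] off
   the sections over [V] are junk. *)
Definition unit_hom_sheaf_iso X Y : Prop :=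
  exists phi : forall V : set Spc,
      germ_fun (unit_hom_presheaf X) -> germ_fun (unit_hom_presheaf Y),
    forall V, open V ->
    [/\ set_bij (unit_hom_sheaf X V) (unit_hom_sheaf Y V) (phi V),
        (forall W s, open W -> W `<=` V -> unit_hom_sheaf X V s ->
          phi W (sec_res W s) = sec_res W (phi V s)),
        (forall s t, unit_hom_sheaf X V s -> unit_hom_sheaf X V t ->
          phi V (sec_add s t) = sec_add (phi V s) (phi V t)) &
        (forall s r, unit_hom_sheaf X V s -> unit_hom_sheaf '1_T V r ->
          phi V (sec_scale s r) = sec_scale (phi V s) r)].

Definition unit_hom_iso X Y : Prop :=
  exists phi : {additive hom '1_T X -> hom '1_T Y},
    bijective phi /\
    forall (m : hom '1_T X) (r : unit_end T), phi (m \oc r) = phi m \oc r.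

Section Comparison.
Variable rho : Spc -> Spec (unit_end T).

Definition is_comparison : Prop :=
  forall P : Spc,
    prime_set (rho P) = [set f | ~ tt_prime P (cone (f : hom '1_T '1_T))].

Hypothesis rhoE : is_comparison.

Lemma denom_inverted (V : set (Spec (unit_end T))) (f : hom '1_T '1_T) :
  denom V f -> inverted (rho @^-1` V) f.
Proof.
move=> Vf L _; apply; split; first by apply: compact_cone; exact: tt_unit_compact.
by move=> P nPf VP; apply: (Vf _ VP); rewrite rhoE.
Qed.

Definition comparison_sec (V : set (Spec (unit_end T)))
    (x : frac_presheaf (unit_end T) V) :
    unit_hom_presheaf '1_T (rho @^-1` V) :=
  lcomp (lgen (val (repr x)).1)
    (linv (denom_inverted (asboolW (valP (repr x))))).

(* The map of sheaves of rings from the structure sheaf of [Spec R_T] to the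
   direct image of that of [Spec T], induced by [comparison_sec] on the open
   sets [D(s)] *)
Definition comparison_sharp (s : germ_fun (frac_presheaf (unit_end T))) :
    germ_fun (unit_hom_presheaf '1_T) :=
  fun P => [set q | exists (U : set (Spec (unit_end T)))
      (a : frac_presheaf (unit_end T) U),
    [/\ Dbasis U, U (rho P), s (rho P) = germ (@Dbasis _) a (rho P) &
        germ qc_open (comparison_sec a) P q]].

(* An isomorphism of locally ringed spaces is a homeomorphism together with an
   isomorphism of sheaves of rings; [comparison_sharp] being a map of sheaves
   of rings, the latter means that it is bijective on sections. *)
Definition comparison_iso : Prop :=
  [/\ bijective rho, continuous rho,
      (forall V, open V -> open (rho @` V)) &
      (forall V, open V ->
        set_bij (sheafify (F := frac_presheaf (unit_end T)) (@Dbasis _) V)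
          (unit_hom_sheaf '1_T (rho @^-1` V)) comparison_sharp)].

End Comparison.

(* Balmer: the sets in [is_comparison] are prime ideals, so that there is
   exactly one comparison map. *)
Definition affine : Prop :=
  exists (rho : Spc -> Spec (unit_end T)) (rhoE : is_comparison rho),
    comparison_iso rhoE.

End TTSpectrum.

(* As they are unique up to unique isomorphism, the truncation functors are part
   of the structure. *)
Record tstructure (T : triangulated) := TStructure {
  tle : int -> set T;
  tge : int -> set T;
  tle_iso : forall n X Y, isomorphic X Y -> tle n X -> tle n Y;
  tge_iso : forall n X Y, isomorphic X Y -> tge n X -> tge n Y;
  tle_shift : forall n X, tle n X <-> tle 0 (sus_pow T n X);
  tge_shift : forall n X, tge n X <-> tge 0 (sus_pow T n X);
  tle_sub : tle 0 `<=` tle 1;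
  tge_sub : tge 1 `<=` tge 0;
  t_orth : forall X Y (f : hom X Y), tle 0 X -> tge 1 Y -> f = 0;
  tau_le : int -> functor T T;
  tau_ge : int -> functor T T;
  tau_leP : forall n X, tle n (tau_le n X);
  tau_geP : forall n X, tge n (tau_ge n X);
  tau_le_in : forall n X, hom (tau_le n X) X;
  tau_ge_out : forall n X, hom X (tau_ge n X);
  tau_bd : forall n X, hom (tau_ge (n + 1) X) (sus T (tau_le n X));
  tau_le_nat : forall n X Y (f : hom X Y),
    f \oc tau_le_in n X = tau_le_in n Y \oc fmap (tau_le n) f;
  tau_ge_nat : forall n X Y (f : hom X Y),
    tau_ge_out n Y \oc f = fmap (tau_ge n) f \oc tau_ge_out n X;
  tau_tri : forall n X,
    distinguished (tau_le_in n X) (tau_ge_out (n + 1) X) (tau_bd n X)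
}.

Definition heart (T : triangulated) (t : tstructure T) : set T :=
  tle t 0 `&` tge t 0.

Definition cohomology (T : triangulated) (t : tstructure T) (n : int) :
    functor T T :=
  fun_comp (tau_ge t 0) (fun_comp (tau_le t 0) (sus_pow T n)).

Section ConnectivelyGenerated.
Variables (T : bigtt) (t : tstructure T).

Definition connectively_generated : Prop :=
  [/\ generating (fun i => sus_pow T i '1_T),
      (forall n : int, (0 < n)%R ->
        forall f : hom '1_T (sus_pow T n '1_T), f = 0),
      (forall n, tle t n = [set X : T | forall i : int, (n < i)%R ->
        forall f : hom '1_T (sus_pow T i X), f = 0]) &
      (forall n, tge t n = [set X : T | forall i : int, (i < n)%R ->
        forall f : hom '1_T (sus_pow T i X), f = 0])].

Definition hearty_replacement (X Y : T) : Prop :=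
  heart t Y /\ unit_hom_sheaf_iso X Y.

End ConnectivelyGenerated.

(* Main.v *)
From HB Require Import structures.
From mathcomp Require Import all_boot all_order all_algebra.
From mathcomp Require Import generic_quotient finmap.
From mathcomp Require Import all_classical topology zify.
Require Import Defs.

Set Implicit Arguments.
Unset Strict Implicit.
Unset Printing Implicit Defensive.

Import GRing.Theory.
Local Open Scope classical_set_scope.
Local Open Scope ring_scope.
Local Open Scope quotient_scope.

(** The truncation triangles give a span [X <- tau_le 0 X -> H^0 X]. Both legs
    are bijective on maps out of the unit, because the third objects of the two
    triangles receive no maps from the unit in the degrees that enter the long
    exact sequence ([tau_le_in_bij], [tau_ge_out_bij]). Inverting the first leg
    yields the isomorphism on [Hom('1_T, -)].

    For the sheaves, the point is that when [T] is affine the sheaf of maps out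
    of the unit depends only on the module [Hom('1_T, X)]. The comparison map
    being a homeomorphism, the loci [Uopen (cone s)], for [s] in the
    endomorphism ring of the unit, form a base ([affine_Uopen_base]), and they
    are quasi-compact ([compact_Uopen]). Over such a locus the maps out of the
    unit to [X] are the fractions [Hom('1_T, X)[1/s]]. Therefore a map of [T]
    that is bijective on [Hom('1_T, -)] is bijective on maps out of the unit
    over every member of the base ([lcomp_unit_bij]), although it need not
    become invertible there, and a span of such maps induces an isomorphism of
    associated sheaves of modules ([span_sec_bij], [span_sec_op]).

    The description by fractions rests on [inverted_torsion]: a map inverted
    over [Uopen (cone s)] has an [s]-torsion cone. A compact object supported
    where the cone of [s] is gets killed by a power of [s], for otherwise some
    prime ideal contains all [s]-torsion compact objects, hence the cone of [s],
    but not the given object ([exists_prime], [supp_torsion]); and [s]-torsion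
    objects, suitably defined, form a localising subcategory
    ([torsion_localising]). It follows that the functor [Hom('1_T, -)[1/s]]
    inverts what is inverted over the locus. Hence it factors through the
    quotient category, so that a map that dies there is killed by a power of
    [s] ([lgen_torsion]), and formal inverses can be cleared from maps out of
    the unit at the cost of a power of [s] ([lhom_clear_denom]). *)

(** * Exact sequences in triangulated categories *)

Section Functors.
Variables (C D : addcat) (F : functor C D).

Lemma functor0 (X Y : C) : fmap F (0 : hom X Y) = 0.
Proof. by apply: (@addrI _ (fmap F 0)); rewrite -fmapD !addr0. Qed.

End Functors.

Section Isomorphisms.
Variable C : addcat.

Lemma is_iso_id (X : C) : is_iso (idm X).
Proof. by exists (idm X); rewrite comp1m. Qed.

Lemma iso_cancelr (W X Y : C) (e : hom W X) (f g : hom X Y) :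
  is_iso e -> f \oc e = g \oc e -> f = g.
Proof.
by move=> [e' [_ ee']] fg; rewrite -[f]compm1 -[g]compm1 -ee' !compA fg.
Qed.

Lemma iso_cancell (X Y Z : C) (e : hom Y Z) (f g : hom X Y) :
  is_iso e -> e \oc f = e \oc g -> f = g.
Proof.
by move=> [e' [e'e _]] fg; rewrite -[f]comp1m -[g]comp1m -e'e -!compA fg.
Qed.

End Isomorphisms.

Section Triangles.
Variable T : triangulated.
Implicit Types W X Y Z : T.

Lemma desus_faithful X Y (f g : hom X Y) :
  fmap (desus T) f = fmap (desus T) g -> f = g.
Proof.
move=> e; apply: (iso_cancelr (sus_counit_iso X)).
by rewrite !sus_counit_nat e.
Qed.

Lemma sus_faithful X Y (f g : hom X Y) :
  fmap (sus T) f = fmap (sus T) g -> f = g.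
Proof.
move=> e; apply: (iso_cancell (sus_unit_iso Y)).
by rewrite !sus_unit_nat e.
Qed.

Lemma sus_full X Y (f : hom (sus T X) (sus T Y)) :
  exists g : hom X Y, f = fmap (sus T) g.
Proof.
have [k [_ kr]] := sus_unit_iso Y.
exists (k \oc fmap (desus T) f \oc sus_unit X); apply: desus_faithful.
apply: (iso_cancelr (sus_unit_iso X)).
by rewrite -sus_unit_nat !compA kr comp1m.
Qed.

Lemma desus_full X Y (f : hom (desus T X) (desus T Y)) :
  exists g : hom X Y, f = fmap (desus T) g.
Proof.
have [k [kl _]] := sus_counit_iso X.
exists (sus_counit Y \oc fmap (sus T) f \oc k); apply: sus_faithful.
apply: (iso_cancell (sus_counit_iso Y)).
by rewrite -sus_counit_nat -!compA kl compm1.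
Qed.

Lemma sus_ess_surj X : exists (X' : T) (e : hom (sus T X') X), is_iso e.
Proof. by exists (desus T X), (sus_counit X); apply: sus_counit_iso. Qed.

(** Exactness of [Hom(W, X) -> Hom(W, Y) -> Hom(W, Z)] in the middle, for all
    [W]. *)
Definition hom_exact X Y Z (f : hom X Y) (g : hom Y Z) : Prop :=
  forall W (u : hom W Y), g \oc u = 0 -> exists v, u = f \oc v.

Lemma triangle_exact X Y Z (f : hom X Y) (g : hom Y Z) (h : hom Z (sus T X)) :
  distinguished f g h -> hom_exact f g.
Proof.
move=> d W u gu0; have := tri_id W.
(* the triangle [W -> 0 -> sus W] maps to the one on [g] and [h] *)
move/tri_rot => d0; move/tri_rot: d => d.
have [|c [_ cE]] := tri_map (a := u) (b := 0) d0 d.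
  by rewrite comp0m gu0.
have [v vE] := sus_full c; exists v; apply: sus_faithful.
move: cE; rewrite fmap1 compmN compm1 vE compNm.
by move=> /oppr_inj->; rewrite fmapM.
Qed.

Lemma triangle_comp0 X Y Z (f : hom X Y) (g : hom Y Z) (h : hom Z (sus T X)) :
  distinguished f g h -> g \oc f = 0.
Proof.
move=> d; have [c [cE _]] := tri_map (a := idm X) (b := f) (tri_id X) d erefl.
by rewrite -cE compm0.
Qed.

Lemma hom_exact_sus X Y Z (f : hom X Y) (g : hom Y Z) :
  hom_exact f g -> hom_exact (fmap (sus T) f) (fmap (sus T) g).
Proof.
move=> fg W u gu0; have [W' [e eI]] := sus_ess_surj W.
have [u' u'E] := sus_full (u \oc e).
have [|v vE] := fg _ u'.
  by apply: sus_faithful; rewrite fmapM -u'E compA gu0 comp0m functor0.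
have [e' [_ ee']] := eI; exists (fmap (sus T) v \oc e').
by rewrite compA -fmapM -vE -u'E -compA ee' compm1.
Qed.

(** A triangle [0 -> X -> Y] exists on every isomorphism [X -> Y]. *)
Lemma triangulated_sub_iso (L : set T) X Y (e : hom X Y) :
  triangulated_sub L -> is_iso e -> L X -> L Y.
Proof.
move=> [L0 _ _ Lcone] eI LX; apply: (Lcone _ _ _ (0 : hom (zob T) X) e 0) => //.
apply/tri_rot; rewrite functor0 oppr0.
have z0 : is_iso (0 : hom (zob T) (sus T (zob T))).
  by exists 0; rewrite !comp0m idm_zob -fmap1 idm_zob functor0.
by apply: (tri_iso (tri_id X) (is_iso_id X) eI z0);
  rewrite ?compm1 ?compm0 ?comp0m.
Qed.

End Triangles.

(** * Compact objects *)

Section CompactObjects.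
Variable T : bigtri.
Implicit Types X Y Z c : T.

Lemma coprod_hom_eq (I : small) (F : I -> T) Y (u v : hom (coprod F) Y) :
  (forall i, u \oc coin F i = v \oc coin F i) -> u = v.
Proof.
have [w [_ uniqw]] := coprodP (fun i => v \oc coin F i).
by move=> uv; rewrite -(uniqw u) // -(uniqw v).
Qed.

Lemma compact_retract X c (i : hom X c) (r : hom c X) :
  r \oc i = idm X -> compact_obj c -> compact_obj X.
Proof.
move=> ri cc I F f; have [s sE] := cc I F (f \oc r).
exists [seq existT _ (projT1 p) (projT2 p \oc i) | p <- s].
rewrite -[LHS]compm1 -ri compA sE comp_suml big_map.
by apply: eq_bigr => p _; rewrite compA.
Qed.

Lemma compact_zob : compact_obj (zob T).
Proof.
move=> I F f; exists [::]; rewrite big_nil.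
by rewrite -[LHS]compm1 idm_zob compm0.
Qed.

(** The universal property of [coprod F] yields a map to
    [desus (coprod (sus F))], which has a left inverse. Hence a map from
    [desus c] to [coprod F] is determined by one from [c] to [coprod (sus F)],
    and a decomposition of the latter gives one of the former. *)
Lemma compact_desus c : compact_obj c -> compact_obj (desus T c).
Proof.
move=> cc I F f; pose G i := sus T (F i).
have unitV i : exists e : hom (desus T (G i)) (F i),
    sus_unit (F i) \oc e = idm _.
  by have [e [_ eK]] := sus_unit_iso (F i); exists e.
have [w [wP _]] :=
  coprodP (fun i => fmap (desus T) (coin G i) \oc sus_unit (F i)).
have [v [vP _]] := coprodP (fun i => fmap (sus T) (coin F i)).
have [k [kl _]] := sus_unit_iso (coprod F).
pose v' := k \oc fmap (desus T) v.
have v'P i : v' \oc fmap (desus T) (coin G i) \oc sus_unit (F i) = coin F i.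
  rewrite /v' -!compA (compA (fmap _ v)) -fmapM vP -sus_unit_nat.
  by rewrite compA kl comp1m.
have wK : v' \oc w = idm _.
  by apply: coprod_hom_eq => i; rewrite comp1m -compA wP compA v'P.
have [t tE] := desus_full (w \oc f).
have [s tsum] := cc I G t.
pose e i := projT1 (cid (unitV i)).
have eK i : sus_unit (F i) \oc e i = idm _ := projT2 (cid (unitV i)).
exists [seq existT _ (projT1 p) (e (projT1 p) \oc fmap (desus T) (projT2 p))
       | p <- s].
rewrite -[LHS]comp1m -wK -compA tE tsum.
have fsum : fmap (desus T) (\sum_(p <- s) (coin G (projT1 p) \oc projT2 p))
    = \sum_(p <- s) fmap (desus T) (coin G (projT1 p) \oc projT2 p).
  by elim: (s) => [|p r IH]; rewrite ?big_nil ?functor0 // !big_cons fmapD IH.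
rewrite fsum comp_sumr big_map; apply: eq_bigr => p _ /=.
by rewrite fmapM -(v'P (projT1 p)) -!compA (compA (sus_unit _)) eK comp1m.
Qed.

(** The third object of any triangle on [f] is a retract of [cone f]: an
    endomorphism of a triangle that is the identity on two of the objects is
    unipotent on the third one. *)
Lemma compact_triangle X Y Z (f : hom X Y) (g : hom Y Z) (h : hom Z (sus T X)) :
  distinguished f g h -> compact_obj X -> compact_obj Y -> compact_obj Z.
Proof.
move=> d cX cY; have dc := tri_cone f.
have idc : idm Y \oc f = f \oc idm X by rewrite comp1m compm1.
have [a [ag ah]] := tri_map d dc idc.
have [b [bg bh]] := tri_map dc d idc.
rewrite fmap1 comp1m in ah; rewrite fmap1 comp1m in bh.
rewrite compm1 in ag; rewrite compm1 in bg.
pose e := b \oc a - idm Z.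
have eg : e \oc g = 0 by rewrite /e compDl compNm comp1m -compA ag bg subrr.
have he : h \oc e = 0 by rewrite /e compDr compmN compm1 compA -bh -ah subrr.
have [v vE] := triangle_exact ((tri_rot f g h).1 d) he.
have ee : e \oc e = 0 by rewrite {2}vE compA eg comp0m.
apply: (@compact_retract _ (cone f) a ((idm Z - e) \oc b)); last first.
  exact: compact_cone.
have ba : b \oc a = idm Z + e by rewrite /e addrC subrK.
(* [b \oc a] is [1 + e] with [e] of square zero, so that [1 - e] inverts it *)
by rewrite -compA ba compDr compm1 compDl compNm ee comp1m oppr0 addr0 subrK.
Qed.

Lemma compact_thick : thick (@compact_obj T).
Proof.
split; last by move=> X Y i r ri cY; apply: compact_retract ri cY.
split; [exact: compact_zob|exact: compact_sus|exact: compact_desus|].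
exact: compact_triangle.
Qed.

End CompactObjects.

(** * The action of endomorphisms of the unit *)

Section UnitAction.
Variable T : bigtt.
Implicit Types (X Y Z : T) (r : unit_end T).

Local Notation M := (tt_monoidal T).

Lemma tens0 X X' Y Y' (g : hom Y Y') : tmap M (0 : hom X X') g = 0.
Proof.
by apply: (@addrI _ (tmap M (0 : hom X X') g)); rewrite -tmapDl !addr0.
Qed.

(** The action of the ring [unit_end T] on every object, that is, the map
    [X \ot r] read through the right unitor. *)
Definition act r X : hom X X :=
  trunit M X \oc tmap M (idm X) r \oc trunit_inv M X.

Lemma act_nat r X Y (f : hom X Y) : f \oc act r X = act r Y \oc f.
Proof.
have inv_nat : trunit_inv M Y \oc f = tmap M f (idm _) \oc trunit_inv M X.
  rewrite -[LHS]compm1 -(trunitVK M X) !compA -[_ \oc f \oc _]compA.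
  by rewrite -trunit_nat !compA trunitK comp1m.
rewrite /act -!compA inv_nat !compA -trunit_nat -!compA.
by congr (_ \oc _); rewrite !compA -!tmapM !comp1m !compm1.
Qed.

Lemma actM r r' X : act (r * r') X = act r X \oc act r' X.
Proof.
rewrite /act -[r * r']/(r \oc r') -{1}[idm X]comp1m tmapM -!compA.
by rewrite (compA (trunit_inv M X)) trunitK comp1m.
Qed.

Lemma act1 X : act 1 X = idm X.
Proof. by rewrite /act -[1]/(idm '1_T) tmap1 compm1 trunitVK. Qed.

Lemma act_unit r : act r '1_T = (r : hom '1_T '1_T).
Proof. by rewrite /act -tlunit1 tlunit_nat -compA tlunit1 trunitVK compm1. Qed.

Lemma act_sus r X : act r (sus T X) = fmap (sus T) (act r X).
Proof.
apply: (iso_cancelr (e := trunit M (sus T X))).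
  by exists (trunit_inv M (sus T X)); rewrite trunitK trunitVK.
rewrite /act -!compA trunitK compm1 -tt_sus_unit -compA -{1}fmap1 tt_sus_nat.
rewrite !fmapM -!compA; congr (_ \oc (_ \oc _)).
by rewrite compA -fmapM trunitK fmap1 comp1m.
Qed.

Lemma act_eq0 r X : act r X = 0 <-> tmap M (idm X) r = 0.
Proof.
rewrite /act; split=> [e|->]; last by rewrite compm0 comp0m.
rewrite -[LHS]comp1m -[LHS]compm1 -!(trunitK M X) !compA.
by rewrite -(compA _ (trunit M X)) -(compA _ (_ \oc _) (trunit_inv M X)) e
  compm0 comp0m.
Qed.

(** Associativity of the tensor product moves [r] next to the factor that it
    kills. *)
Lemma act_tens0 r X Y : act r X = 0 -> act r (X \ot Y) = 0.
Proof.
move=> /act_eq0 e; apply/act_eq0.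
apply: (iso_cancell (e := tswap M (X \ot Y) '1_T)).
  by exists (tswap M '1_T (X \ot Y)); rewrite !tswapK.
rewrite compm0 tswap_nat.
have {}e : tmap M r (idm X) = 0.
  apply: (iso_cancelr (e := tswap M X '1_T)).
    by exists (tswap M '1_T X); rewrite !tswapK.
  by rewrite comp0m -tswap_nat e compm0.
suff -> : tmap M r (idm (X \ot Y)) = 0 by rewrite comp0m.
apply: (iso_cancelr (e := tassoc M '1_T X Y)).
  by exists (tassoc_inv M '1_T X Y); rewrite tassocK tassocVK.
rewrite -tmap1 -tassoc_nat e comp0m.
by rewrite tens0 compm0.
Qed.

End UnitAction.

(** * Tensor ideals of compact objects and primes *)

Section TensorIdeals.
Variable T : bigtt.
Implicit Types (X Y Z a b c d : T) (M : set T).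

Local Notation TM := (tt_monoidal T).

Definition tensor_ideal M : Prop :=
  [/\ M `<=` @compact_obj T, thick M &
      forall a c, M a -> compact_obj c -> M (a \ot c)].

Lemma tensor_ideal_iso M X Y (e : hom X Y) :
  tensor_ideal M -> is_iso e -> M X -> M Y.
Proof. by move=> [_ [triM _] _]; apply: triangulated_sub_iso. Qed.

Lemma tswap_iso X Y : is_iso (tswap TM X Y).
Proof. by exists (tswap TM Y X); rewrite !tswapK. Qed.

Lemma tassoc_iso X Y Z : is_iso (tassoc TM X Y Z).
Proof. by exists (tassoc_inv TM X Y Z); rewrite tassocK tassocVK. Qed.

Lemma tassoc_inv_iso X Y Z : is_iso (tassoc_inv TM X Y Z).
Proof. by exists (tassoc TM X Y Z); rewrite tassocK tassocVK. Qed.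

Lemma tens_iso X Y Z W (f : hom X Y) (g : hom Z W) :
  is_iso f -> is_iso g -> is_iso (tmap TM f g).
Proof.
move=> [f' [f'f ff']] [g' [g'g gg']]; exists (tmap TM f' g').
by rewrite -!tmapM f'f g'g ff' gg' !tmap1.
Qed.

Lemma tensor_idealC M a b : tensor_ideal M -> M (a \ot b) -> M (b \ot a).
Proof. by move=> idM; apply: tensor_ideal_iso (tswap_iso _ _). Qed.

Lemma tensor_idealAC M a b c :
  tensor_ideal M -> M (a \ot b \ot c) -> M (a \ot c \ot b).
Proof.
move=> idM m; apply: (tensor_ideal_iso idM (tassoc_inv_iso _ _ _)).
apply: (tensor_ideal_iso idM (tens_iso (is_iso_id a) (tswap_iso b c))).
exact: (tensor_ideal_iso idM (tassoc_iso _ _ _) m).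
Qed.

(** The ideal quotient of [M] by [b]. *)
Definition colon M b : set T := [set x | compact_obj x /\ M (x \ot b)].

Lemma is_iso_inv X Y (e : hom X Y) :
  is_iso e -> exists e' : hom Y X, is_iso e'.
Proof. by move=> [e' [e'e ee']]; exists e', e. Qed.

Lemma colon_ideal M b :
  tensor_ideal M -> compact_obj b -> tensor_ideal (colon M b).
Proof.
move=> idM cb; have [subM [[M0 Msus Mdesus Mcone] Mret] Mtens] := idM.
have iso X Y (e : hom X Y) := tensor_ideal_iso (e := e) idM.
have [[c0 csus cdesus ccone] cret] := @compact_thick T.
split=> [x []//||x c [cx Mxb] cc]; last first.
  by split; [apply: tt_tens_compact|apply: tensor_idealAC => //; apply: Mtens].
split; last first.
  move=> X Y i r ri [cY MYb]; split; first exact: cret ri cY.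
  by apply: (Mret _ _ (tmap TM i (idm b)) (tmap TM r (idm b))) MYb;
    rewrite -tmapM ri comp1m tmap1.
split.
- split=> //; apply: (iso (zob T) _ 0) M0; exists 0.
  by rewrite comp0m compm0 idm_zob -tmap1 idm_zob tens0.
- move=> X [cX MXb]; split; first exact: csus.
  have [e eI] := is_iso_inv (tt_sus_iso X b).
  by apply: (iso _ _ _ eI); apply: Msus.
- move=> X [cX MXb]; split; first exact: cdesus.
  have [e eI] := is_iso_inv (sus_unit_iso (desus T X \ot b)).
  apply: (iso _ _ _ eI); apply: Mdesus; apply: (iso _ _ _ (tt_sus_iso _ _)).
  have [k kI] := is_iso_inv (sus_counit_iso X).
  exact: (iso _ _ _ (tens_iso kI (is_iso_id b))).
- move=> X Y Z f g h d [cX MXb] [cY MYb]; split; first exact: ccone d cX cY.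
  exact: Mcone (tt_exact b d) MXb MYb.
Qed.

(** The triangle identity makes [x] a retract of [x \ot d \ot x], where [d] is
    its dual. *)
Lemma tensor_ideal_radical M x :
  tensor_ideal M -> compact_obj x -> M (x \ot x) -> M x.
Proof.
move=> idM cx Mxx; have [subM [_ Mret] Mtens] := idM.
have [d [eta [eps [cd [zig _]]]]] := tt_rigid cx.
apply: (Mret _ _ (tmap TM eta (idm x) \oc tlunit_inv TM x)
  (trunit TM x \oc tmap TM (idm x) eps \oc tassoc TM x d x)).
  by rewrite compA zig tlunitVK.
by apply: tensor_idealAC => //; apply: Mtens.
Qed.

(** An ideal [M] maximal among those without [t] is prime: if [a \ot b] lies in
    [M] but neither factor does, then the larger ideals [colon M b] and then
    [colon M t] contain [t], so that [t \ot t] and hence [t] lie in [M]. *)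
Lemma exists_prime M t : tensor_ideal M -> compact_obj t -> ~ M t ->
  exists P : Spc T, M `<=` tt_prime P /\ ~ tt_prime P t.
Proof.
move=> idM ct nMt.
(* adjoining [M] to the members of the family lets it contain [set0], the union
   of the empty chain *)
pose fam (A : set T) := tensor_ideal (M `|` A) /\ ~ (M `|` A) t.
have [|A [[idA nAt] maxA]] := @Zorn_bigcup _ fam.
  move=> F famF totF; set U := \bigcup_(A in F) A.
  have dir x y : (M `|` U) x -> (M `|` U) y ->
      exists A, [/\ fam A, A `<=` U, (M `|` A) x & (M `|` A) y].
    have fam0 : fam set0 by rewrite /fam setU0.
    have sub A : F A -> A `<=` U by move=> FA z Az; exists A.
    move=> [Mx|[A FA Ax]] [My|[B FB By]].
    + by exists set0; split=> //; left.
    + by exists B; split; [exact: famF|exact: sub|left|right].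
    + by exists A; split; [exact: famF|exact: sub|right|left].
    + have [AB|BA] := totF _ _ FA FB.
        by exists B; split; [exact: famF|exact: sub|right; apply: AB|right].
      by exists A; split; [exact: famF|exact: sub|right|right; apply: BA].
  have up A : A `<=` U -> M `|` A `<=` M `|` U by move=> AU; apply: setUS.
  split; last by move=> Ut; have [A [[_ nAt] _ At _]] := dir t t Ut Ut.
  split.
  - move=> x Ux; have [A [[[sub _ _] _] _ Ax _]] := dir x x Ux Ux.
    exact: sub.
  - split; first split.
    + by left; have [_ [[]]] := idM.
    + move=> X UX; have [A [[[_ [[_ sA _ _] _] _] _] AU AX _]] := dir X X UX UX.
      by apply: (up A) => //; apply: sA.
    + move=> X UX; have [A [[[_ [[_ _ sA _] _] _] _] AU AX _]] := dir X X UX UX.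
      by apply: (up A) => //; apply: sA.
    + move=> X Y Z f g h d UX UY.
      have [A [[[_ [[_ _ _ sA] _] _] _] AU AX AY]] := dir X Y UX UY.
      by apply: (up A) => //; apply: sA d AX AY.
    + move=> X Y i r ri UY.
      have [A [[[_ [_ sA] _] _] AU AY _]] := dir Y Y UY UY.
      by apply: (up A) => //; apply: sA ri AY.
  - move=> a c Ua cc; have [A [[[_ _ sA] _] AU Aa _]] := dir a a Ua Ua.
    by apply: (up A) => //; apply: sA.
set N := M `|` A in idA nAt *.
have larger b x : compact_obj b -> N (x \ot b) -> compact_obj x -> ~ N x ->
    N (t \ot b).
  move=> cb Nxb cx nNx; apply: contrapT => nNtb.
  have Nsub : N `<=` colon N b.
    by move=> y Ny; have [subN _ tN] := idA; split; [exact: subN|exact: tN].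
  apply: (maxA (colon N b)).
    split; first by move=> y Ay; apply: Nsub; right.
    by move=> /(_ x (conj cx Nxb)) Ax; apply: nNx; right.
  rewrite /fam (_ : M `|` colon N b = colon N b); last first.
    by rewrite setUidr // => y My; apply: Nsub; left.
  by split; [exact: colon_ideal|case].
have pN : prime_ideal N.
  have [subN tN mN] := idA; split=> //; first by exists t.
  move=> a b ca cb Nab; apply: contrapT => /not_orP[nNa nNb].
  have Nbt := tensor_idealC idA (larger b a cb Nab ca nNa).
  by apply: nAt; apply: tensor_ideal_radical (larger t b ct Nbt cb nNb).
by exists (MkSpc pN); split=> // x Mx; left.
Qed.

End TensorIdeals.

(** * Torsion for an endomorphism of the unit *)

Section Torsion.
Variables (T : bigtt) (s : unit_end T).
Implicit Types (X Y Z a c : T).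

Lemma act_exprD m n X :
  act (s ^+ (m + n)) X = act (s ^+ m) X \oc act (s ^+ n) X.
Proof. by rewrite exprD actM. Qed.

Definition torsion_ideal : set T :=
  [set a | compact_obj a /\ exists n, act (s ^+ n) a = 0].

Lemma torsion_ideal_tensor_ideal : tensor_ideal torsion_ideal.
Proof.
have [[c0 csus cdesus ccone] cret] := @compact_thick T.
split=> [a []//||a c [ca [n e]] cc]; last first.
  by split; [exact: tt_tens_compact|exists n; apply: act_tens0].
split; last first.
  move=> X Y i r ri [cY [n e]]; split; first exact: cret ri cY.
  by exists n; rewrite -[LHS]comp1m -ri -compA act_nat e comp0m compm0.
split.
- by split=> //; exists 0%N; rewrite act1 idm_zob.
- move=> X [cX [n e]]; split; first exact: csus.
  by exists n; rewrite act_sus e functor0.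
- move=> X [cX [n e]]; split; first exact: cdesus.
  exists n; apply: sus_faithful; rewrite functor0 -act_sus.
  apply: (iso_cancell (sus_counit_iso X)).
  by rewrite act_nat e comp0m compm0.
- move=> X Y Z f g h d [cX [m eX]] [cY [n eY]]; split.
    exact: ccone d cX cY.
  have [|u uE] := triangle_exact ((tri_rot f g h).1 d) (u := act (s ^+ m) Z).
    by rewrite act_nat act_sus eX functor0 comp0m.
  by exists (n + m)%N; rewrite act_exprD uE compA -act_nat eY compm0 comp0m.
Qed.

Local Notation cone_s := (cone (s : hom '1_T '1_T)).

(** Already [s ^+ 2] kills the cone: the action of [s] on the cone followed by
    the map to [sus '1_T] is zero, so that this action factors through
    [cone_in s]; acting with [s] once more gives a map through
    [cone_in s \oc s], which is zero. *)
Lemma cone_torsion : torsion_ideal cone_s.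
Proof.
have cone_compact : compact_obj cone_s.
  by apply: compact_cone; exact: tt_unit_compact.
split=> //; exists 2%N; have d := tri_cone (s : hom '1_T '1_T).
have out0 := triangle_comp0 ((tri_rot _ _ _).1 ((tri_rot _ _ _).1 d)).
have [|u uE] := triangle_exact ((tri_rot _ _ _).1 d) (u := act s cone_s).
  rewrite act_nat act_sus act_unit.
  by move/eqP: out0; rewrite compNm oppr_eq0 => /eqP.
rewrite expr2 actM {2}uE compA -act_nat act_unit.
by rewrite (triangle_comp0 d) comp0m.
Qed.

(** If no power of [s] killed [t], some prime would contain all the compact
    [s]-torsion, among it the cone of [s], but not [t]. *)
Lemma supp_torsion t :
  compact_obj t -> supp t `<=` supp cone_s -> torsion_ideal t.
Proof.
move=> ct st; apply: contrapT => nt.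
have [P [tP nPt]] := exists_prime torsion_ideal_tensor_ideal ct nt.
by apply: (st P nPt); apply/tP/cone_torsion.
Qed.

(** Torsion is tested on maps out of compact objects and not on the identity:
    a coproduct of objects killed by powers of [s] need not be killed by a
    single power. *)
Definition torsion : set T :=
  [set X | forall c (m : hom c X), compact_obj c ->
    exists n, act (s ^+ n) X \oc m = 0].

Lemma torsion_mono m n X c (f : hom c X) :
  act (s ^+ n) X \oc f = 0 -> act (s ^+ (m + n)) X \oc f = 0.
Proof. by move=> e; rewrite act_exprD -compA e compm0. Qed.

Lemma torsion_sus X : torsion X -> torsion (sus T X).
Proof.
move=> tX c m cc; have [m' m'E] := sus_full (m \oc sus_counit c).
have [n e] := tX _ m' (compact_desus cc).
exists n; apply: (iso_cancelr (sus_counit_iso c)).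
by rewrite -compA m'E act_sus -fmapM e functor0 comp0m.
Qed.

Lemma torsion_localising : localising torsion.
Proof.
split; first split.
- by move=> c m _; exists 0%N; rewrite act1 idm_zob comp0m.
- exact: torsion_sus.
- move=> X tX c m cc.
  have [n e] := tX _ (sus_counit X \oc fmap (sus T) m) (compact_sus cc).
  exists n; apply: sus_faithful; rewrite functor0 fmapM -act_sus.
  apply: (iso_cancell (sus_counit_iso X)).
  by rewrite compA act_nat -compA e compm0.
- move=> X Y Z f g h d tX tY c m cc.
  have [n e] := torsion_sus tX (h \oc m) cc.
  have d' := (tri_rot f g h).1 d.
  have [|u uE] := triangle_exact d' (u := act (s ^+ n) Z \oc m).
    by rewrite compA act_nat -compA.
  have [k ke] := tY _ u cc; exists (k + n)%N.
  by rewrite act_exprD -compA uE compA -act_nat -compA ke compm0.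
- move=> I F tF c m cc; have [r ->] := cc I F m.
  elim: r => [|[i f] r [n e]]; first by exists 0%N; rewrite big_nil compm0.
  have [k ke] := tF i _ f cc; exists (n + k)%N.
  rewrite big_cons compDr addnC (torsion_mono k e) addr0 addnC /=.
  by apply: torsion_mono; rewrite compA -act_nat -compA ke compm0.
Qed.

(** Over the locus where the cone of [s] vanishes only [s]-torsion is
    divided out. *)
Lemma inverted_torsion X Y (f : hom X Y) :
  inverted (Uopen cone_s) f -> torsion (cone f).
Proof.
apply; first exact: torsion_localising.
move=> t [ct st]; have [_ [n e]] : torsion_ideal t.
  by apply: supp_torsion => // P /st nUP nPs; apply: nUP.
by move=> c m _; exists n; rewrite e comp0m.
Qed.

End Torsion.

(** * Localised categories *)

Section LocalisedCategory.
Variables (C : addcat) (W : forall X Y : C, hom X Y -> Prop).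
Arguments W {X Y}.
Implicit Types X Y Z V : C.

Lemma lcompA X Y Z V
    (h : lhom (@W) Z V) (g : lhom (@W) Y Z) (f : lhom (@W) X Y) :
  lcomp h (lcomp g f) = lcomp (lcomp h g) f.
Proof.
rewrite -[h]lpi_repr -[g]lpi_repr -[f]lpi_repr !lpi_comp.
by apply/lpiP; apply: lrel_compA.
Qed.

Lemma lcomp1m X Y (f : lhom (@W) X Y) : lcomp (lgen (idm Y)) f = f.
Proof. by rewrite -[f]lpi_repr lpi_comp; apply/lpiP; apply: lrel_comp1m. Qed.

Lemma lcompm1 X Y (f : lhom (@W) X Y) : lcomp f (lgen (idm X)) = f.
Proof. by rewrite -[f]lpi_repr lpi_comp; apply/lpiP; apply: lrel_compm1. Qed.

Lemma lpiD X Y (t u : lterm (@W) X Y) : lpi (LAdd t u) = lpi t + lpi u.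
Proof. by rewrite -lpi_add. Qed.

Lemma lcompDl X Y Z (g g' : lhom (@W) Y Z) (f : lhom (@W) X Y) :
  lcomp (g + g') f = lcomp g f + lcomp g' f.
Proof.
rewrite -[g]lpi_repr -[g']lpi_repr -[f]lpi_repr -lpiD !lpi_comp -lpiD.
by apply/lpiP; apply: lrel_compDl.
Qed.

Lemma lcompDr X Y Z (g : lhom (@W) Y Z) (f f' : lhom (@W) X Y) :
  lcomp g (f + f') = lcomp g f + lcomp g f'.
Proof.
rewrite -[g]lpi_repr -[f']lpi_repr -[f]lpi_repr -lpiD !lpi_comp -lpiD.
by apply/lpiP; apply: lrel_compDr.
Qed.

Lemma lcompm0 X Y Z (g : lhom (@W) Y Z) : lcomp g (0 : lhom (@W) X Y) = 0.
Proof. by apply: (@addrI _ (lcomp g 0)); rewrite -lcompDr !addr0. Qed.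

Lemma lcomp0m X Y Z (f : lhom (@W) X Y) : lcomp (0 : lhom (@W) Y Z) f = 0.
Proof. by apply: (@addrI _ (lcomp 0 f)); rewrite -lcompDl !addr0. Qed.

Lemma lcompmB X Y Z (g : lhom (@W) Y Z) (f f' : lhom (@W) X Y) :
  lcomp g (f - f') = lcomp g f - lcomp g f'.
Proof. by apply: (@addIr _ (lcomp g f')); rewrite -lcompDr !subrK. Qed.

Lemma lgenM X Y Z (g : hom Y Z) (f : hom X Y) :
  lgen (g \oc f) = lcomp (lgen g) (lgen f) :> lhom (@W) X Z.
Proof. by rewrite lpi_comp; apply/lpiP; apply: lrel_genM. Qed.

Lemma lgenD X Y (f g : hom X Y) :
  lgen (f + g) = lgen f + lgen g :> lhom (@W) X Y.
Proof. by rewrite -lpiD; apply/lpiP; apply: lrel_genD. Qed.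

Lemma linvl X Y (f : hom X Y) (wf : W f) :
  lcomp (linv (W := @W) wf) (lgen f) = lgen (idm X).
Proof. by rewrite lpi_comp; apply/lpiP; apply: lrel_invl. Qed.

Lemma linvr X Y (f : hom X Y) (wf : W f) :
  lcomp (lgen f) (linv (W := @W) wf) = lgen (idm Y).
Proof. by rewrite lpi_comp; apply/lpiP; apply: lrel_invr. Qed.

(** An additive functor [E] to abelian groups that inverts [W] factors through
    the localisation, so that maps that [E] separates remain distinct there. *)
Lemma lgen_separated (E : C -> zmodType)
    (Ef : forall X Y, hom X Y -> E X -> E Y) :
  (forall X, Ef X X (idm X) =1 id) ->
  (forall X Y Z (g : hom Y Z) (f : hom X Y) x,
    Ef X Z (g \oc f) x = Ef Y Z g (Ef X Y f x)) ->
  (forall X Y (f g : hom X Y) x, Ef X Y (f + g) x = Ef X Y f x + Ef X Y g x) ->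
  (forall X Y (f : hom X Y), {morph Ef X Y f : x y / x + y}) ->
  (forall X Y (f : hom X Y), W f ->
    injective (Ef X Y f) /\ forall y, exists x, Ef X Y f x = y) ->
  forall X Y (f g : hom X Y),
    lgen f = lgen g :> lhom (@W) X Y -> Ef X Y f =1 Ef X Y g.
Proof.
move=> Ef1 EfM EfDl EfDr EfW X Y f g.
pose Einv A B (h : hom A B) (wh : W h) y := projT1 (cid ((EfW A B h wh).2 y)).
have EinvK A B (h : hom A B) (wh : W h) y : Ef A B h (Einv A B h wh y) = y :=
  projT2 (cid ((EfW A B h wh).2 y)).
pose fix ev A B (t : lterm (@W) A B) : E A -> E B :=
  match t with
  | LGen _ _ h => Ef _ _ h
  | LInv _ _ _ wh => Einv _ _ _ wh
  | LComp _ _ _ t u => fun x => ev _ _ t (ev _ _ u x)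
  | LAdd _ _ t u => fun x => ev _ _ t x + ev _ _ u x
  end.
have evD A B (t : lterm (@W) A B) : {morph ev A B t : x y / x + y}.
  elim: t => {A B} /= [A B h|A B h wh|A B D t IHt u IHu|A B t IHt u IHu] x y.
  - exact: EfDr.
  - by apply: (EfW _ _ _ wh).1; rewrite EfDr !EinvK.
  - by rewrite IHu IHt.
  - by rewrite IHt IHu addrACA.
have Ef0 A B x : Ef A B 0 x = 0.
  by apply: (@addrI _ (Ef A B 0 x)); rewrite -EfDl !addr0.
have evP A B (t u : lterm (@W) A B) : lrel t u -> ev A B t =1 ev A B u.
  elim=> {A B t u} //=.
  - by move=> A B t u _ e x; rewrite e.
  - by move=> A B t u v _ e _ e' x; rewrite e e'.
  - by move=> A B D t t' u u' _ e _ e' x; rewrite e e'.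
  - by move=> A B t t' u u' _ e _ e' x; rewrite e e'.
  - by move=> A B t x; rewrite Ef1.
  - by move=> A B t x; rewrite Ef1.
  - by move=> A B D t u v x; rewrite evD.
  - by move=> A B t u v x; rewrite addrA.
  - by move=> A B t u x; rewrite addrC.
  - by move=> A B t x; rewrite Ef0 add0r.
  - by move=> A B t x; rewrite Ef0 -{2}[ev A B t x]Ef1 -EfDl addNr Ef0.
  - by move=> A B h wh x; apply: (EfW _ _ _ wh).1; rewrite EinvK Ef1.
  - by move=> A B h wh x; rewrite EinvK Ef1.
by move=> /lpiP/evP.
Qed.

End LocalisedCategory.

(** * Fractions of maps out of the unit *)

Section Fractions.
Variables (T : bigtt) (s : unit_end T).
Implicit Types X Y : T.

Local Notation sact n X := (act (s ^+ n) X).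

Section Quotient.
Variable X : T.
Implicit Types p q r : hom '1_T X * nat.

(** A pair [(m, n)] stands for the fraction with numerator [m] and denominator
    [s ^+ n]. *)
Definition ufrac_eq p q : bool :=
  `[< exists k, sact (k + q.2) X \oc p.1 = sact (k + p.2) X \oc q.1 >].

Lemma ufrac_eq_refl : reflexive ufrac_eq.
Proof. by move=> p; apply/asboolP; exists 0%N. Qed.

Lemma ufrac_eq_sym : symmetric ufrac_eq.
Proof. by move=> p q; apply/asboolP/asboolP => -[k e]; exists k. Qed.

Lemma sactC m n (f : hom '1_T X) :
  sact m X \oc (sact n X \oc f) = sact n X \oc (sact m X \oc f).
Proof. by rewrite compA -act_exprD addnC act_exprD -compA. Qed.

Lemma sactD m n (f : hom '1_T X) :
  sact (m + n) X \oc f = sact m X \oc (sact n X \oc f).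
Proof. by rewrite compA -act_exprD. Qed.

Lemma ufrac_eq_trans : transitive ufrac_eq.
Proof.
move=> [y j] [x i] [z l] /asboolP[k /= e] /asboolP[k' /= e']; apply/asboolP.
exists (k + k' + j)%N => /=.
rewrite (_ : (k + k' + j + l = k' + l + (k + j))%N); last by lia.
rewrite (_ : (k + k' + j + i = k + i + (k' + j))%N); last by lia.
by rewrite !(sactD (_ + _)) e -e' sactC.
Qed.

Canonical ufrac_equiv :=
  EquivRel ufrac_eq ufrac_eq_refl ufrac_eq_sym ufrac_eq_trans.

Definition ufrac := {eq_quot ufrac_eq}.
HB.instance Definition _ : EqQuotient _ ufrac_eq ufrac := EqQuotient.on ufrac.
HB.instance Definition _ := Choice.on ufrac.

Definition upi p : ufrac := \pi p.

Lemma upiP p q : upi p = upi q <->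
  exists k, sact (k + q.2) X \oc p.1 = sact (k + p.2) X \oc q.1.
Proof. by split=> [/eqmodP/asboolP|e]; last exact/eqmodP/asboolP. Qed.

Lemma upi_repr (x : ufrac) : upi (repr x) = x.
Proof. exact: reprK. Qed.

Lemma ufracW (P : ufrac -> Prop) : (forall p, P (upi p)) -> forall x, P x.
Proof. by move=> Pp x; rewrite -[x]upi_repr. Qed.

Definition ufrac_add (x y : ufrac) : ufrac :=
  let p := repr x in let q := repr y in
  upi (sact q.2 X \oc p.1 + sact p.2 X \oc q.1, (p.2 + q.2)%N).

Definition ufrac_opp (x : ufrac) : ufrac := upi (- (repr x).1, (repr x).2).

Lemma upi_add p q : ufrac_add (upi p) (upi q)
  = upi (sact q.2 X \oc p.1 + sact p.2 X \oc q.1, (p.2 + q.2)%N).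
Proof.
have [k e] := (upiP _ _).1 (upi_repr (upi p)).
have [k' e'] := (upiP _ _).1 (upi_repr (upi q)).
apply/upiP; exists (k + k')%N; move: (repr _) (repr _) e e'.
case: p q => [x i] [y j] [z l] [w m] /= e e'.
rewrite !compDr -!sactD; congr (_ + _).
  rewrite (_ : (k + k' + (i + j) + l = k' + j + l + (k + i))%N); last by lia.
  rewrite (_ : (k + k' + (m + l) + j = k' + j + l + (k + m))%N); last by lia.
  by rewrite sactD e -sactD.
rewrite (_ : (k + k' + (i + j) + m = k + i + m + (k' + j))%N); last by lia.
rewrite (_ : (k + k' + (m + l) + i = k + i + m + (k' + l))%N); last by lia.
by rewrite sactD e' -sactD.
Qed.

Lemma upi_opp p : ufrac_opp (upi p) = upi (- p.1, p.2).
Proof.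
have [k e] := (upiP _ _).1 (upi_repr (upi p)).
by apply/upiP; exists k; rewrite /= !compmN e.
Qed.

Lemma ufrac_addA : associative ufrac_add.
Proof.
elim/ufracW=> [[x i]]; elim/ufracW=> [[y j]]; elim/ufracW=> [[z l]].
rewrite !upi_add /= addnA !compDr -!sactD addrA.
by rewrite (addnC l i) (addnC l j).
Qed.

Lemma ufrac_addC : commutative ufrac_add.
Proof.
elim/ufracW=> [[x i]]; elim/ufracW=> [[y j]].
by rewrite !upi_add /= addrC addnC.
Qed.

Lemma ufrac_add0 : left_id (upi (0, 0%N)) ufrac_add.
Proof.
by elim/ufracW=> [[x i]]; rewrite upi_add /= compm0 add0r act1 comp1m add0n.
Qed.

Lemma ufrac_addN : left_inverse (upi (0, 0%N)) ufrac_opp ufrac_add.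
Proof.
elim/ufracW=> [[x i]]; rewrite upi_opp upi_add /= compmN addNr.
by apply/upiP; exists 0%N; rewrite !compm0.
Qed.

HB.instance Definition _ :=
  GRing.isZmodule.Build ufrac ufrac_addA ufrac_addC ufrac_add0 ufrac_addN.

End Quotient.

Lemma upiD X (p q : hom '1_T X * nat) : upi p + upi q
  = upi (sact q.2 X \oc p.1 + sact p.2 X \oc q.1, (p.2 + q.2)%N).
Proof. exact: upi_add. Qed.

Lemma upi_shift X k n (m : hom '1_T X) :
  upi (sact k X \oc m, (k + n)%N) = upi (m, n).
Proof. by apply/upiP; exists 0%N; rewrite /= -sactD !add0n addnC. Qed.

Lemma upi_eq0 X n (m : hom '1_T X) :
  upi (m, n) = 0 <-> exists k, sact k X \oc m = 0.
Proof.
split=> [/upiP[k /= e]|[k e]].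
  by exists k; rewrite -[k]addn0 e compm0.
by rewrite -(upi_shift k) e; apply/upiP; exists 0%N; rewrite !compm0.
Qed.

Lemma sact_nat n X Y (f : hom X Y) (m : hom '1_T X) :
  sact n Y \oc (f \oc m) = f \oc (sact n X \oc m).
Proof. by rewrite compA -act_nat -compA. Qed.

Definition ufrac_map X Y (f : hom X Y) (x : ufrac X) : ufrac Y :=
  upi (f \oc (repr x).1, (repr x).2).

Lemma ufrac_map_upi X Y (f : hom X Y) n (m : hom '1_T X) :
  ufrac_map f (upi (m, n)) = upi (f \oc m, n).
Proof.
have [k e] := (upiP _ _).1 (upi_repr (upi (m, n))).
by apply/upiP; exists k; rewrite /= !sact_nat e.
Qed.

Lemma ufrac_mapD X Y (f : hom X Y) : {morph ufrac_map f : x y / x + y}.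
Proof.
elim/ufracW=> [[x i]]; elim/ufracW=> [[y j]].
by rewrite upiD !ufrac_map_upi upiD /= compDr !sact_nat.
Qed.

(** By the long exact sequence, the obstructions to the injectivity and
    surjectivity of [f] on maps out of the unit are maps to [cone f], from the
    suspended unit and from the unit. Powers of [s] kill both. *)
Lemma ufrac_map_bij X Y (f : hom X Y) : torsion s (cone f) ->
  injective (ufrac_map f) /\ forall y, exists x, ufrac_map f x = y.
Proof.
move=> tf; have d := tri_cone f.
have d1 := (tri_rot _ _ _).1 d; have d2 := (tri_rot _ _ _).1 d1.
have ker0 x : ufrac_map f x = 0 -> x = 0.
  elim/ufracW: x => [[m n]]; rewrite ufrac_map_upi => /upi_eq0[k e].
  have [|v vE] := triangle_exact d2 (u := fmap (sus T) (sact k X \oc m)).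
    by rewrite compNm -fmapM compA act_nat -compA e functor0 oppr0.
  have [j je] := tf _ v (compact_sus (@tt_unit_compact T)).
  apply/upi_eq0; exists (j + k)%N; apply: sus_faithful.
  rewrite functor0 sactD fmapM vE -act_sus compA -act_nat -compA je.
  by rewrite compm0.
split=> [x x' e|].
  apply/eqP; rewrite -subr_eq0; apply/eqP/ker0.
  by apply: (@addIr _ (ufrac_map f x')); rewrite -ufrac_mapD subrK add0r.
elim/ufracW=> [[m n]].
have [k e] := tf _ (cone_in f \oc m) (@tt_unit_compact T).
have [|v vE] := triangle_exact d (u := sact k Y \oc m).
  by rewrite compA act_nat -compA.
by exists (upi (v, (k + n)%N)); rewrite ufrac_map_upi -vE upi_shift.
Qed.

(** * Maps out of the unit where an endomorphism is invertible *)

Local Notation U := (Uopen (cone (s : hom '1_T '1_T))).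

(** A map that vanishes over [U] also vanishes as a fraction, since fractions
    are functorial and invert what is inverted over [U]. *)
Lemma lgen_torsion X (m : hom '1_T X) :
  lgen m = 0 :> hom_over U '1_T X -> exists k, sact k X \oc m = 0.
Proof.
move=> e.
suff : ufrac_map m (upi (idm _, 0%N)) = ufrac_map 0 (upi (idm _, 0%N)).
  by rewrite !ufrac_map_upi compm1 comp0m => /upiP[k /= ke]; exists k;
    rewrite -[k]addn0 ke compm0.
apply: (@lgen_separated T (@inverted T U) (fun X => ufrac X) ufrac_map);
  last (exact: e); move=> {X m e}.
- by move=> X; elim/ufracW=> [[m n]]; rewrite ufrac_map_upi comp1m.
- by move=> X Y Z g f; elim/ufracW=> [[m n]]; rewrite !ufrac_map_upi compA.
- move=> X Y f g; elim/ufracW=> [[m n]]; rewrite !ufrac_map_upi upiD /=.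
  by rewrite -compDr -compDl upi_shift.
- by move=> X Y f; exact: ufrac_mapD.
- by move=> X Y f /inverted_torsion; exact: ufrac_map_bij.
Qed.

Lemma lact_nat (V : set (Spc T)) r X Y (a : hom_over V X Y) :
  lcomp (lgen (act r Y)) a = lcomp a (lgen (act r X)).
Proof.
rewrite -[a]lpi_repr; elim: (repr a) => {X Y a}.
- by move=> X Y f; rewrite -!lgenM act_nat.
- move=> X Y f wf; rewrite -/(linv wf).
  rewrite -[RHS]lcompm1 -(linvr wf) lcompA -(lcompA (linv wf)).
  by rewrite -lgenM -act_nat lgenM lcompA linvl lcomp1m.
- by move=> X Y Z t IHt u IHu; rewrite -lpi_comp lcompA IHt -!lcompA IHu.
- by move=> X Y t IHt u IHu; rewrite lpiD lcompDl lcompDr IHt IHu.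
Qed.

(** Every map out of the unit in the quotient is a fraction: formal inverses
    can be removed because, up to powers of [s], maps out of the unit lift
    along the maps that are inverted. *)
Lemma lhom_clear_denom X (a : hom_over U '1_T X) :
  exists n m, lcomp (lgen (sact n X)) a = lgen m.
Proof.
suff gen A (t : lterm (@inverted T U) A X) (u : hom '1_T A) :
    exists n m, lcomp (lgen (sact n X)) (lcomp (lpi t) (lgen u)) = lgen m.
  have [n [m e]] := gen _ (repr a) (idm _).
  by exists n, m; rewrite -e lpi_repr lcompm1.
elim: t u => {A X a}.
- by move=> A X f u; exists 0%N, (f \oc u); rewrite act1 lcomp1m lgenM.
- move=> A X f wf u; have [_ surj] := ufrac_map_bij (inverted_torsion wf).
  have [x] := surj (upi (u, 0%N)); elim/ufracW: x => [[v n]].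
  rewrite ufrac_map_upi => /upiP[k /= e]; exists (k + n)%N, (sact k A \oc v).
  rewrite lcompA lact_nat -lcompA -lgenM -e addn0 sact_nat lgenM lcompA.
  by rewrite linvl lcomp1m.
- move=> A Y X t IHt u IHu v; have [n [m e]] := IHu v.
  have [k [w e']] := IHt m; exists (k + n)%N, w.
  rewrite -e' -e -lpi_comp act_exprD lgenM !lcompA; congr lcomp; congr lcomp.
  by rewrite -!lcompA (lact_nat _ (lpi t)).
- move=> A X t IHt u IHu v; have [n [m e]] := IHt v; have [k [w e']] := IHu v.
  exists (k + n)%N, (sact k X \oc m + sact n X \oc w).
  rewrite lpiD lcompDl lcompDr lgenD !lgenM -e -e' !lcompA -!lgenM.
  by rewrite -!act_exprD [(n + k)%N]addnC.
Qed.

(** The cone of [s] is itself supported off [U]. *)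
Lemma denom_invertible n :
  exists q : hom_over U '1_T '1_T, lcomp (lgen (sact n '1_T)) q = lgen (idm _).
Proof.
have ws : inverted U (s : hom '1_T '1_T).
  move=> L _; apply; split=> [|P nPs]; last exact: nPs.
  by apply: compact_cone; exact: tt_unit_compact.
elim: n => [|n [q qE]]; first by exists (lgen (idm _)); rewrite act1 lcomp1m.
exists (lcomp q (linv ws)); rewrite exprS actM act_unit lgenM.
by rewrite lcompA -(lcompA (lgen s)) qE lcompm1 linvr.
Qed.

(** Over [U], maps out of the unit to [X] are the fractions of maps ['1_T -> X],
    so that they depend on these maps and the action of [s] only. The map [f]
    itself need not become invertible over [U]. *)
Lemma lcomp_unit_bij X Y (f : hom X Y) :
  bijective (fun m : hom '1_T X => f \oc m) ->
  injective (fun a : hom_over U '1_T X => lcomp (lgen f) a) /\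
  forall b : hom_over U '1_T Y, exists a, lcomp (lgen f) a = b.
Proof.
move=> [g gf fg]; split.
  have ker0 (a : hom_over U '1_T X) : lcomp (lgen f) a = 0 -> a = 0.
    move=> fa0; have [n [m e]] := lhom_clear_denom a.
    have [|k ke] := @lgen_torsion Y (f \oc m).
      by rewrite lgenM -e lcompA -lgenM act_nat lgenM -lcompA fa0 lcompm0.
    have m0 : sact k X \oc m = 0.
      by apply: (can_inj gf); rewrite -sact_nat ke compm0.
    have [q qE] := denom_invertible (k + n).
    rewrite -[a]lcompm1 -qE lcompA -lact_nat act_exprD lgenM.
    by rewrite -(lcompA (lgen _)) e -lgenM m0; exact: lcomp0m.
  move=> a b e; apply/eqP; rewrite -subr_eq0; apply/eqP/ker0.
  by rewrite lcompmB e subrr.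
move=> b; have [n [m e]] := lhom_clear_denom b.
have [q qE] := denom_invertible n.
exists (lcomp (lgen (g m)) q).
by rewrite lcompA -lgenM fg -e lact_nat -lcompA qE lcompm1.
Qed.

End Fractions.

(** * Topology of the two spectra *)

Section SpcTopology.
Variable T : bigtt.
Implicit Types (a b c : T) (P : Spc T).

Lemma open_Uopen a : compact_obj a -> open (Uopen a).
Proof.
move=> ca; exists [set Uopen a]; last exact: bigcup_set1.
move=> _ ->; exists [fset (Uopen a : set (Spc T))]%fset.
  by move=> A /fset1P->; apply/mem_set; exists a.
by rewrite set_fset1 bigcap_set1.
Qed.

(** The sets [Uopen b] generate the topology. *)
Lemma Spc_cvg (F : set_system (Spc T)) P : Filter F ->
  (forall b, compact_obj b -> tt_prime P b -> F (Uopen b)) -> F --> P.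
Proof.
move=> FF FP B; rewrite nbhsE => -[U [[D DI <-] [A DA AP]] UB].
apply: filterS UB _; apply: (@filterS _ _ _ A); first by move=> Q AQ; exists A.
have [E ED AE] := DI A DA; rewrite -AE in AP *; apply: filter_bigI => C CE.
have /set_mem[b cb bC] := ED C CE.
by rewrite -bC; apply: FP => //; move: (AP C CE); rewrite -bC.
Qed.

Lemma Spc_tensor_ideal P : tensor_ideal (tt_prime P).
Proof. by have [] := tt_prime_ideal P. Qed.

Lemma prime_not_unit P : ~ tt_prime P '1_T.
Proof.
move=> P1; have [_ _ Pt [c cc nPc] _] := tt_prime_ideal P; apply: nPc.
apply: (tensor_ideal_iso (Spc_tensor_ideal P) (e := tlunit (tt_monoidal T) c)).
  by exists (tlunit_inv (tt_monoidal T) c); rewrite tlunitK tlunitVK.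
exact: Pt.
Qed.

(** An ultrafilter on the spectrum converges to the prime of the objects [b]
    whose locus [Uopen b] it contains. *)
Lemma compact_Uopen a : compact_obj a -> compact (Uopen a).
Proof.
move=> ca; rewrite compact_ultra => F FU Fa.
have FF : ProperFilter F := ultra_proper.
pose N : set T := [set b | compact_obj b /\ F (Uopen b)].
have [[c0 csus cdesus ccone] cret] := @compact_thick T.
have pN : prime_ideal N.
  split=> [b []//||b c [cb Fb] cc||b c cb cc [_ Fbc]].
  - split.
      split=> [|X [cX FX]|X [cX FX]|X Y Z f g h d [cX FX] [cY FY]].
      + split=> //; apply: filterS filterT => P _.
        by have [_ [[]]] := tt_prime_ideal P.
      + split; [exact: csus|apply: filterS FX => P PX].
        by have [_ [[_ sP _ _] _] _ _ _] := tt_prime_ideal P; apply: sP.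
      + split; [exact: cdesus|apply: filterS FX => P PX].
        by have [_ [[_ _ sP _] _] _ _ _] := tt_prime_ideal P; apply: sP.
      + split; [exact: ccone d cX cY|].
        apply: filterS (filterI FX FY) => P [PX PY].
        by have [_ [[_ _ _ sP] _] _ _ _] := tt_prime_ideal P; apply: sP d PX PY.
    move=> X Y i r ri [cY FY]; split; [exact: cret ri cY|].
    apply: filterS FY => P PY.
    by have [_ [_ sP] _ _ _] := tt_prime_ideal P; apply: sP ri PY.
  - split; [exact: tt_tens_compact|apply: filterS Fb => P Pb].
    by have [_ _ sP] := Spc_tensor_ideal P; apply: sP.
  - exists '1_T; first exact: tt_unit_compact.
    move=> [_ F1]; apply: (@filter_not_empty _ F _); apply: filterS F1 => P.
    exact: prime_not_unit.
  - have [Fb|nFb] := in_ultra_setVsetC (Uopen b) FU; first by left.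
    right; split=> //; apply: filterS (filterI Fbc nFb) => P [Pbc nPb].
    have [_ _ _ _ sP] := tt_prime_ideal P.
    by have [|//] := sP b c cb cc Pbc.
by exists (MkSpc pN); split=> //; apply: Spc_cvg => b _ [].
Qed.

Lemma qc_open_Uopen a : compact_obj a -> qc_open (Uopen a).
Proof. by move=> ca; split; [exact: open_Uopen|exact: compact_Uopen]. Qed.

End SpcTopology.

Section SpecTopology.
Variable R : comPzRingType.
Implicit Types (p : Spec R) (U : set (Spec R)).

(** Finite intersections of the sets [Dopen s] are again of this form, by
    multiplying the elements. *)
Lemma Dopen_base U p :
  open U -> U p -> exists2 s : R, Dopen s p & Dopen s `<=` U.
Proof.
move=> [D DI <-] [A DA Ap]; have [E ED AE] := DI A DA.
have [s sp sE] : exists2 s : R, Dopen s p &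
    forall C, C \in enum_fset E -> Dopen s `<=` C.
  have : forall C, C \in enum_fset E -> range (@Dopen R) C /\ C p.
    move=> C CE; split; first exact/set_mem/ED.
    by move: Ap; rewrite -AE; apply.
  elim: (enum_fset E) => [|C r IH] rE.
    by exists 1 => //; exact: prime_set1.
  have [|s sp sr] := IH; first by move=> B Br; apply: rE; rewrite inE Br orbT.
  have [[t _ tC] Cp] := rE C (mem_head _ _); exists (s * t).
    by rewrite -tC in Cp; move=> /prime_set_prime[].
  move=> B; rewrite inE => /predU1P[->|/sr sB] q nq.
    by rewrite -tC => qt; apply: nq; apply: prime_setM.
  by apply: sB => qs; apply: nq; rewrite mulrC; apply: prime_setM.
exists s => // q sq; exists A => //; suff : A q by [].
by rewrite -AE => C CE; apply: sE CE q sq.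
Qed.

End SpecTopology.

(** The comparison map is injective and open, and pulls [Dopen s] back to
    [Uopen (cone s)]. *)
Lemma affine_Uopen_base (T : bigtt) (U : set (Spc T)) P :
  affine T -> open U -> U P ->
  exists2 s : unit_end T, Uopen (cone (s : hom '1_T '1_T)) P
    & Uopen (cone (s : hom '1_T '1_T)) `<=` U.
Proof.
move=> [rho [rhoE [/bij_inj rho_inj _ rho_open _]]] oU UP.
have rhoD (s : unit_end T) Q :
    Dopen s (rho Q) <-> Uopen (cone (s : hom '1_T '1_T)) Q.
  rewrite /Dopen /Uopen /= rhoE; split=> [/contrapT//|PQ]; exact.
have [|s /rhoD sP sU] := Dopen_base (rho_open _ oU) (p := rho P).
  by exists P.
by exists s => // Q /rhoD/sU[Q' UQ' /rho_inj <-].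
Qed.

(** * Associated sheaves along spans of presheaves *)

Section Germs.
Variables (X : Type) (B good : set (set X)).
Hypothesis goodB : good `<=` B.
Hypothesis good_base : forall U V x, B U -> B V -> U x -> V x ->
  exists W, [/\ good W, W x, W `<=` U & W `<=` V].
Implicit Types (U V W : set X) (F G H : presheaf X).

Lemma germ_self F U (a : F U) x :
  B U -> U x -> germ B a x (existT _ U a).
Proof.
move=> BU Ux; split=> //; exists U, (@subset_refl _ U), (@subset_refl _ U).
by split.
Qed.

Lemma germ_res F U V (a : F U) (VU : V `<=` U) x :
  B V -> V x -> germ B (pres VU a) x = germ B a x.
Proof.
move=> BV Vx; apply/seteqP; split=> -[Q b] [/= BQ Qx [W [hV [hQ [BW Wx e]]]]].
  split=> //; exists W, (fun _ h => VU _ (hV _ h)), hQ; split=> //.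
  by rewrite -e; apply/esym/pres_comp.
have [W' [/goodB BW' W'x W'W W'V]] := good_base BW BV Wx Vx.
split=> //; exists W', W'V, (fun _ h => hQ _ (W'W _ h)); split=> //.
have W'U : W' `<=` U by move=> y /W'V/VU.
by rewrite -(pres_comp hQ W'W) -e (pres_comp VU W'V W'U) (pres_comp hV W'W W'U).
Qed.

Lemma germ_eq F U V (a : F U) (b : F V) x : B U -> U x -> B V -> V x ->
  germ B a x = germ B b x ->
  exists W (WU : W `<=` U) (WV : W `<=` V),
    [/\ good W, W x & pres WU a = pres WV b].
Proof.
move=> BU Ux BV Vx e; have := germ_self a BU Ux; rewrite e.
move=> [/= _ _ [Q [hV [hU [BQ Qx eq]]]]].
have [W [gW Wx WQ _]] := good_base BQ BQ Qx Qx.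
exists W, (fun _ h => hU _ (WQ _ h)), (fun _ h => hV _ (WQ _ h)); split=> //.
by rewrite -(pres_comp hU WQ) -(pres_comp hV WQ) eq.
Qed.

Definition natural F G (g : forall U, F U -> G U) : Prop :=
  forall U V (VU : V `<=` U) a, pres VU (g U a) = g V (pres VU a).

(** Germs are taken over all of [B], while bijectivity is asked for over the
    smaller base [good] only. *)
Definition bij_on_base F G (g : forall U, F U -> G U) : Prop :=
  forall W, good W -> injective (g W) /\ forall b, exists a, g W a = b.

(** The map of germs induced by a span [G <- F -> H] of presheaves whose first
    leg is bijective on a base. The definition lifts a germ along [g] and pushes
    it forward along [f]; being symmetric in the legs, it is inverted by
    exchanging them. *)
Definition span_sec F G H (g : forall U, F U -> G U) (f : forall U, F U -> H U)
    (s : germ_fun G) : germ_fun H :=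
  fun x => [set q | exists U (c : F U),
    [/\ B U, U x, s x = germ B (g U c) x & germ B (f U c) x q]].

Section Span.
Variables (F G H : presheaf X).
Variables (g : forall U, F U -> G U) (f : forall U, F U -> H U).
Hypotheses (gN : natural g) (fN : natural f) (gB : bij_on_base g).

(** Two lifts along [g] of the same germ agree near the point, because [g] is
    injective on arbitrarily small members of the base. *)
Lemma span_sec_germ (s : germ_fun G) U (c : F U) x : B U -> U x ->
  s x = germ B (g c) x -> span_sec g f s x = germ B (f c) x.
Proof.
move=> BU Ux sx; apply/seteqP; split=> q; last by exists U, c.
move=> [V [d [BV Vx]]]; rewrite sx => /esym e fq.
have [W [WV [WU [gW Wx]]]] := germ_eq BV Vx BU Ux e.
rewrite !gN => /(gB gW).1 dc; have BW := goodB gW.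
by rewrite -(germ_res (f c) WU BW Wx) fN -dc -fN germ_res.
Qed.

Lemma span_sec_set0 (s : germ_fun G) x : s x = set0 -> span_sec g f s x = set0.
Proof.
move=> s0; apply/seteqP; split=> // q [U [c [BU Ux sx _]]].
by have := germ_self (g c) BU Ux; rewrite -sx s0.
Qed.

Lemma section_lift V (s : germ_fun G) x : sheafify B V s -> V x ->
  exists U (c : F U), [/\ good U, U x, U `<=` V
    & forall y, U y -> s y = germ B (g c) y].
Proof.
move=> [_ sV] /sV[Q [a [BQ Qx QV sQ]]].
have [W [gW Wx WQ _]] := good_base BQ BQ Qx Qx.
have [c cE] := (gB gW).2 (pres WQ a).
exists W, c; split=> // [y /WQ/QV//|y Wy].
rewrite cE germ_res //; last exact: goodB.
exact: sQ (WQ y Wy).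
Qed.

Lemma span_sec_sheafify V (s : germ_fun G) :
  sheafify B V s -> sheafify B V (span_sec g f s).
Proof.
move=> sS; split=> [x nVx|x Vx]; first by apply: span_sec_set0; apply: sS.1.
have [U [c [gU Ux UV sU]]] := section_lift sS Vx.
exists U, (f c); split=> // [|y Uy]; first exact: goodB.
by apply: span_sec_germ (sU y Uy) => //; apply: goodB.
Qed.

Lemma span_sec_res W (s : germ_fun G) :
  span_sec g f (sec_res W s) = sec_res W (span_sec g f s).
Proof.
apply/funext => x; have [Wx|nWx] := pselect (W x).
  have resE K (t : germ_fun K) : sec_res W t x = t x.
    by apply/seteqP; split=> [q []|q].
  by rewrite resE /span_sec resE.
have resE K (t : germ_fun K) : sec_res W t x = set0.
  by apply/seteqP; split=> [q []|q].
by rewrite resE span_sec_set0.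
Qed.

End Span.

Lemma span_secK F G H
    (g : forall U, F U -> G U) (f : forall U, F U -> H U) V s :
  natural g -> natural f -> bij_on_base g -> bij_on_base f ->
  sheafify B V s -> span_sec f g (span_sec g f s) = s.
Proof.
move=> gN fN gB fB sS; apply/funext => x; have [Vx|nVx] := pselect (V x).
  have [U [c [/goodB BU Ux UV sU]]] := section_lift gB sS Vx.
  rewrite (sU x Ux); apply: span_sec_germ => //.
  exact: span_sec_germ (sU x Ux).
by rewrite !span_sec_set0 // sS.1.
Qed.

Lemma span_sec_bij F G H
    (g : forall U, F U -> G U) (f : forall U, F U -> H U) V :
  natural g -> natural f -> bij_on_base g -> bij_on_base f ->
  set_bij (@sheafify X B G V) (@sheafify X B H V) (span_sec g f).
Proof.
move=> gN fN gB fB; split.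
- by move=> s sS; apply: span_sec_sheafify.
- move=> s t /set_mem sS /set_mem tS e.
  by rewrite -(span_secK gN fN gB fB sS) e (span_secK gN fN gB fB tS).
- move=> t tS; exists (span_sec f g t); first exact: span_sec_sheafify.
  exact: span_secK tS.
Qed.

Lemma span_sec_id F V (s : germ_fun F) : sheafify B V s ->
  span_sec (fun U (a : F U) => a) (fun U (a : F U) => a) s = s.
Proof.
have idN : natural (fun U (a : F U) => a) by [].
have idB : bij_on_base (fun U (a : F U) => a).
  by move=> W _; split=> // b; exists b.
move=> sS; apply/funext => x; have [Vx|nVx] := pselect (V x).
  have [U [c [/goodB BU Ux UV sU]]] := section_lift idB sS Vx.
  by rewrite (sU x Ux); apply: span_sec_germ (sU x Ux).
by rewrite !span_sec_set0 // sS.1.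
Qed.

Section Operations.
Variables (F G H F' G' H' : presheaf X).
Variables (g : forall U, F U -> G U) (f : forall U, F U -> H U).
Variables (g' : forall U, F' U -> G' U) (f' : forall U, F' U -> H' U).
Hypotheses (gN : natural g) (fN : natural f) (gB : bij_on_base g).
Hypotheses (gN' : natural g') (fN' : natural f') (gB' : bij_on_base g').
Variables (opF : forall U, F U -> F' U -> F U)
  (opG : forall U, G U -> G' U -> G U)
  (opH : forall U, H U -> H' U -> H U).
Hypothesis opGN : forall U V (VU : V `<=` U) a b,
  pres VU (opG a b) = opG (pres VU a) (pres VU b).
Hypothesis opHN : forall U V (VU : V `<=` U) a b,
  pres VU (opH a b) = opH (pres VU a) (pres VU b).
Hypothesis g_op : forall U (a : F U) b, g (opF a b) = opG (g a) (g' b).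
Hypothesis f_op : forall U (a : F U) b, f (opF a b) = opH (f a) (f' b).

Lemma sec_op_germ (K K' : presheaf X) (op : forall U, K U -> K' U -> K U)
    (s : germ_fun K) (t : germ_fun K') U (a : K U) (b : K' U) x :
  (forall U V (VU : V `<=` U) a b,
    pres VU (op U a b) = op V (pres VU a) (pres VU b)) ->
  B U -> U x -> s x = germ B a x -> t x = germ B b x ->
  sec_op B op s t x = germ B (op U a b) x.
Proof.
move=> opN BU Ux sx tx; apply/seteqP; split=> q; last by exists U, a, b.
move=> [V [c [d [BV Vx]]]]; rewrite sx tx => ac bd opq.
have [W [WU [WV [gW Wx eac]]]] := germ_eq BU Ux BV Vx ac.
have [Q [QU [QV [gQ Qx ebd]]]] := germ_eq BU Ux BV Vx bd.
have [N [/goodB BN Nx NW NQ]] := good_base (goodB gW) (goodB gQ) Wx Qx.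
have NU : N `<=` U by move=> y /NW/WU.
have NV : N `<=` V by move=> y /NW/WV.
rewrite -(germ_res _ NU) // opN.
have -> : pres NU a = pres NV c.
  by rewrite -(pres_comp WU NW) eac pres_comp.
have -> : pres NU b = pres NV d.
  by rewrite -(pres_comp QU NQ) ebd pres_comp.
by rewrite -opN germ_res.
Qed.

Lemma sec_op_set0 (K K' : presheaf X) (op : forall U, K U -> K' U -> K U)
    (s : germ_fun K) (t : germ_fun K') x :
  s x = set0 -> sec_op B op s t x = set0.
Proof.
move=> s0; apply/seteqP; split=> // q [U [a [b [BU Ux sx _ _]]]].
by have := germ_self a BU Ux; rewrite -sx s0.
Qed.

Lemma span_sec_op V s t : sheafify B V s -> sheafify B V t ->
  span_sec g f (sec_op B opG s t)
  = sec_op B opH (span_sec g f s) (span_sec g' f' t).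
Proof.
move=> sS tS; apply/funext => x; have [Vx|nVx] := pselect (V x); last first.
  by rewrite span_sec_set0 ?sec_op_set0 ?span_sec_set0 ?sS.1.
have [U [c [gU Ux UV sU]]] := section_lift gB sS Vx.
have [U' [d [gU' U'x _ tU]]] := section_lift gB' tS Vx.
have [W [/goodB BW Wx WU WU']] := good_base (goodB gU) (goodB gU') Ux U'x.
have sx : s x = germ B (g (pres WU c)) x by rewrite -gN germ_res // sU.
have tx : t x = germ B (g' (pres WU' d)) x by rewrite -gN' germ_res // tU.
pose e := opF (pres WU c) (pres WU' d).
rewrite (span_sec_germ gN fN gB (U := W) (c := e)) //.
  rewrite f_op; symmetry; apply: sec_op_germ => //; exact: span_sec_germ.
by rewrite g_op; apply: sec_op_germ.
Qed.

End Operations.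
End Germs.

(** * The sheaf of maps out of the unit of an affine category *)

Section UnitHomSheaf.
Variable T : bigtt.
Implicit Types X Y Z : T.

Lemma lmap_comp_lcomp (V U : set (Spc T)) (VU : V `<=` U) X Y Z
    (a : hom_over U Y Z) (b : hom_over U X Y) :
  lmap (inverted_sub VU) (lcomp a b)
  = lcomp (lmap (inverted_sub VU) a) (lmap (inverted_sub VU) b).
Proof. by rewrite -[a]lpi_repr -[b]lpi_repr lpi_comp !lpi_map lpi_comp. Qed.

Lemma lmapD (V U : set (Spc T)) (VU : V `<=` U) X Y (a b : hom_over U X Y) :
  lmap (inverted_sub VU) (a + b)
  = lmap (inverted_sub VU) a + lmap (inverted_sub VU) b.
Proof. by rewrite -[a]lpi_repr -[b]lpi_repr -lpiD !lpi_map lpiD. Qed.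

Definition unit_hom_map X Y (f : hom X Y) (U : set (Spc T))
    (a : unit_hom_presheaf X U) : unit_hom_presheaf Y U :=
  lcomp (lgen f) (a : hom_over U '1_T X).

Lemma unit_hom_map_natural X Y (f : hom X Y) : natural (unit_hom_map f).
Proof. by move=> U V VU a; rewrite /= lmap_comp_lcomp lpi_map. Qed.

Definition principal_opens : set (set (Spc T)) :=
  [set U | exists s : unit_end T, U = Uopen (cone (s : hom '1_T '1_T))].

Lemma principal_opens_qc : principal_opens `<=` qc_open (T := T).
Proof.
move=> _ [s ->]; apply: qc_open_Uopen; apply: compact_cone;
  exact: tt_unit_compact.
Qed.

Hypothesis affT : affine T.

Lemma principal_opens_base U V (P : Spc T) :
  qc_open U -> qc_open V -> U P -> V P ->
  exists W, [/\ principal_opens W, W P, W `<=` U & W `<=` V].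
Proof.
move=> [oU _] [oV _] UP VP.
have [s sP sUV] := affine_Uopen_base affT (openI oU oV) (conj UP VP).
by exists (Uopen (cone (s : hom '1_T '1_T))); split=> // [|Q /sUV[]|Q /sUV[]];
  first by exists s.
Qed.

Lemma unit_hom_map_bij X Y (f : hom X Y) :
  bijective (fun m : hom '1_T X => f \oc m) ->
  bij_on_base principal_opens (unit_hom_map f).
Proof. by move=> f_bij _ [s ->]; apply: lcomp_unit_bij. Qed.

(** A span is what the truncations of a t-structure provide between an object
    and its cohomology. *)
Lemma unit_hom_sheaf_iso_span Z X Y (g : hom Z X) (f : hom Z Y) :
  bijective (fun m : hom '1_T Z => g \oc m) ->
  bijective (fun m : hom '1_T Z => f \oc m) ->
  unit_hom_sheaf_iso X Y.
Proof.
move=> /unit_hom_map_bij gB /unit_hom_map_bij fB.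
have gN := unit_hom_map_natural g; have fN := unit_hom_map_natural f.
have span_op := span_sec_op principal_opens_qc principal_opens_base gN fN gB.
exists (fun=> span_sec (@qc_open T) (unit_hom_map g) (unit_hom_map f)).
move=> V oV; split.
- exact: (span_sec_bij principal_opens_qc principal_opens_base V gN fN gB fB).
- by move=> W s _ _ _; exact: span_sec_res.
- move=> s t sS tS.
  apply: (span_op _ _ _ _ _ gN fN gB (@over_add T Z) (@over_add T X)
    (@over_add T Y) _ _ _ _ V s t sS tS) => U.
  + by move=> W WU a b; exact: lmapD.
  + by move=> W WU a b; exact: lmapD.
  + by move=> a b; exact: lcompDr.
  + by move=> a b; exact: lcompDr.
- move=> s r sS rS.
  pose id1 U (a : unit_hom_presheaf '1_T U) := a.
  have idN : natural id1 by [].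
  have idB : bij_on_base principal_opens id1.
    by move=> W _; split=> // b; exists b.
  rewrite -[in RHS](span_sec_id principal_opens_qc principal_opens_base rS).
  apply: (span_op _ _ _ _ _ idN idN idB (@over_scale T Z) (@over_scale T X)
    (@over_scale T Y) _ _ _ _ V s r sS rS) => U.
  + by move=> W WU a b; exact: lmap_comp_lcomp.
  + by move=> W WU a b; exact: lmap_comp_lcomp.
  + by move=> a b; exact: lcompA.
  + by move=> a b; exact: lcompA.
Qed.

End UnitHomSheaf.

(** * The t-structure generated by the unit *)

Section Heart.
Variables (T : bigtt) (t : tstructure T).
Hypothesis ht : connectively_generated t.
Implicit Types X Y Z : T.

Lemma tle_hom0 n i X (f : hom '1_T (sus_pow T i X)) :
  tle t n X -> (n < i)%R -> f = 0.
Proof. by case: ht => _ _ -> _ tX ni; apply: tX. Qed.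

Lemma tge_hom0 n i X (f : hom '1_T (sus_pow T i X)) :
  tge t n X -> (i < n)%R -> f = 0.
Proof. by case: ht => _ _ _ -> tX ni; apply: tX. Qed.

(** The two vanishing hypotheses kill the neighbours of [Hom('1_T, X)] and
    [Hom('1_T, Y)] in the long exact sequence of the triangle. *)
Lemma unit_hom_bij X Y Z (f : hom X Y) (g : hom Y Z) (h : hom Z (sus T X)) :
  distinguished f g h ->
  (forall u : hom '1_T Z, u = 0) -> (forall u : hom (sus T '1_T) Z, u = 0) ->
  bijective (fun m : hom '1_T X => f \oc m).
Proof.
move=> d Z0 sZ0; have d2 := (tri_rot _ _ _).1 ((tri_rot _ _ _).1 d).
have inj : injective (fun m : hom '1_T X => f \oc m).
  move=> m m' e; apply/eqP; rewrite -subr_eq0; apply/eqP.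
  have [|v vE] := triangle_exact d2 (u := fmap (sus T) (m - m')).
    by rewrite compNm -fmapM compDr compmN e subrr functor0 oppr0.
  by apply: sus_faithful; rewrite vE (sZ0 v) compm0 functor0.
have surj (y : hom '1_T Y) : exists m, f \oc m = y.
  by have [v ->] := triangle_exact d (Z0 (g \oc y)); exists v.
exists (fun y => projT1 (cid (surj y))) => [m|y];
  last exact: projT2 (cid (surj y)).
by apply: inj; exact: projT2 (cid (surj _)).
Qed.

(** The third object [tau_ge 1 X] of the triangle has maps out of the unit in
    positive degrees only. *)
Lemma tau_le_in_bij X :
  bijective (fun m : hom '1_T (tau_le t 0 X) => tau_le_in t 0 X \oc m).
Proof.
have ge1 := tau_geP t (0 + 1) X.
apply: (unit_hom_bij (tau_tri t 0 X)) => u.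
  exact: (tge_hom0 (i := 0) u ge1).
(* a map from [sus '1_T] is a map from the unit in degree -1 *)
apply: desus_faithful; apply: (iso_cancelr (sus_unit_iso '1_T)).
by rewrite functor0 comp0m; exact: (tge_hom0 (i := -1) _ ge1).
Qed.

Lemma sus_tau_lt0_hom0 X (u : hom '1_T (sus T (tau_le t (-1) X))) : u = 0.
Proof. exact: (tle_hom0 (i := 1) u (tau_leP t (-1) X)). Qed.

Lemma tau_ge_out_bij X :
  bijective (fun m : hom '1_T X => tau_ge_out t 0 X \oc m).
Proof.
have d : distinguished (tau_le_in t (-1) X) (tau_ge_out t 0 X)
    (tau_bd t (-1) X).
  exact: tau_tri.
apply: (unit_hom_bij ((tri_rot _ _ _).1 d)) => u; first exact: sus_tau_lt0_hom0.
have [v ->] := sus_full u.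
by rewrite (tle_hom0 (i := 0) v (tau_leP t (-1) X)) // functor0.
Qed.

Lemma sus_pow_sus n X : sus_pow T (Posz n) (sus T X) = sus_pow T (Posz n.+1) X.
Proof. by elim: n => //= n ->. Qed.

(** Truncating [Z := tau_le 0 X] from below keeps it connective: in positive
    degree [n], maps from the unit to [tau_ge 0 Z] sit between those to [Z] in
    degree [n] and those to [tau_le (-1) Z] in degree [n + 1], all zero. *)
Lemma cohomology_heart X : heart t (cohomology t 0 X).
Proof.
set Z := tau_le t 0 (sus_pow T 0 X); split; last exact: tau_geP.
rewrite -[cohomology _ _ _]/(tau_ge t 0 Z); case: (ht) => _ _ -> _ [n|//] n0 u.
have d : distinguished (tau_le_in t (-1) Z) (tau_ge_out t 0 Z)
    (tau_bd t (-1) Z).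
  exact: tau_tri.
have ex : hom_exact (fmap (sus_pow T (Posz n)) (tau_ge_out t 0 Z))
    (fmap (sus_pow T (Posz n)) (tau_bd t (-1) Z : hom (tau_ge t 0 Z) _)).
  elim: (n) => [|k IH]; first exact: triangle_exact ((tri_rot _ _ _).1 d).
  exact: hom_exact_sus IH.
have [|v ->] := ex _ u.
  move: (_ \oc u); rewrite sus_pow_sus => w.
  exact: (tle_hom0 (i := Posz n.+1) w (tau_leP t (-1) Z)).
by rewrite (tle_hom0 (i := Posz n) v (tau_leP t 0 _)) // compm0.
Qed.

Lemma unit_hom_iso_span X Y Z (g : hom Z X) (f : hom Z Y) :
  bijective (fun m : hom '1_T Z => g \oc m) ->
  bijective (fun m : hom '1_T Z => f \oc m) ->
  unit_hom_iso X Y.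
Proof.
move=> [g' gK Kg] f_bij; pose phi (m : hom '1_T X) := f \oc g' m.
have phiB : zmod_morphism phi.
  move=> a b; rewrite /phi -compmN -compDr; congr (_ \oc _).
  by apply: (can_inj gK); rewrite compDr compmN !Kg.
pose phiA : {additive hom '1_T X -> hom '1_T Y} :=
  HB.pack phi (GRing.isZmodMorphism.Build _ _ phi phiB).
exists phiA; split.
  by apply: bij_comp f_bij _; exists (fun m => g \oc m).
move=> m r; rewrite /= /phi -compA; congr (_ \oc _).
by apply: (can_inj gK); rewrite compA !Kg.
Qed.

End Heart.

Theorem proposition9p14 (T : bigtt) (t : tstructure T)
    (ht : connectively_generated t) :
  (forall X : T, unit_hom_iso X (cohomology t 0 X)) /\
  (affine T -> forall X : T, unit_hom_sheaf_iso X (cohomology t 0 X)) /\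
  (affine T -> forall X : T, hearty_replacement t X (cohomology t 0 X)).
Proof.
have sheaf_iso : affine T ->
    forall X : T, unit_hom_sheaf_iso X (cohomology t 0 X).
  move=> affT X; apply: (unit_hom_sheaf_iso_span affT (tau_le_in_bij ht X)).
  exact: tau_ge_out_bij.
split=> [X|].
  exact: unit_hom_iso_span (tau_le_in_bij ht X) (tau_ge_out_bij ht _).
split=> // affT X; split; [exact: cohomology_heart|exact: sheaf_iso].
Qed.
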